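(* For any $n\ge3$ there are $A\in\Omega_n$ and $B\in C_A$ such that $k_{\Omega_n}(A;B)>0$.
   Context: $\mathbb D$ is the open unit disc in $\mathbb C$. $\mathcal M_n$ is the set of all $n\times n$ complex matrices (identified with $\mathbb C^{n^2}$). For $A\in\mathcal M_n$, $sp(A)$ is the spectrum (set of eigenvalues) of $A$ and $r(A)=\max_{\lambda\in sp(A)}|\lambda|$ its spectral radius. The spectral ball is $\Omega_n:=\{A\in\mathcal M_n: r(A)<1\}$. For $A\in\Omega_n$, the isospectral variety is $L_A:=\{C\in\Omega_n: sp(C)=sp(A)\}$, and $C_A$ is the tangent cone to $L_A$ at $A$: $C_A$ is the set of all $B\in\mathcal M_n$ for which there exist matrices $C_j\in L_A$ with $C_j\to A$ and real numbers $c_j>0$ ($j=1,2,\dots$) such that $c_j(C_j-A)\to B$ as $j\to\infty$. The Kobayashi--Royden pseudometric of $\Omega_n$ is $$k_{\Omega_n}(A;B):=\inf\{|\alpha|:\alpha\in\mathbb C\text{ and there is a holomorphic }\varphi:\mathbb D\to\Omega_n\text{ with }\varphi(0)=A,\ \alpha\varphi'(0)=B\}.$$ *)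

(* Defs.v *)
From HB Require Import structures.
From mathcomp Require Import all_boot all_order all_algebra.
From mathcomp Require Import complex.
From mathcomp Require Import all_classical all_reals all_analysis.

Set Implicit Arguments.
Unset Strict Implicit.
Unset Printing Implicit Defensive.

Import Order.TTheory GRing.Theory Num.Theory.
Import numFieldNormedType.Exports.

Local Open Scope classical_set_scope.
Local Open Scope complex_scope.
Local Open Scope ring_scope.

(* The complex numbers over R, packed as a numClosedFieldType so that the
   generic topology of a numFieldType and the normed C-module structure on
   matrices are found by unification. *)
Definition Cplx (R : realType) : numClosedFieldType := R[i].

Section SpectralBall.
Context {R : realType}.
Local Notation C := (Cplx R).

Definition modulus (z : C) : R := Normc.normc z.

Definition open_unit_disc : set C := [set z | modulus z < 1].

(* derivable f z 1 is the existence of the limit of the difference quotient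
   along increments h : C, i.e. complex differentiability. *)
Definition holomorphic_on_disc (V : normedModType C) (f : C -> V) : Prop :=
  forall z, open_unit_disc z -> derivable f z 1.

(* Since f is a total function, only its values on the disc matter. The set is
   bounded below by 0 and, for D open and a in D, nonempty. *)
Definition kobayashi_royden (V : normedModType C) (D : set V) (a v : V) : R :=
  inf [set t : R | exists (alpha : C) (f : C -> V),
    [/\ t = modulus alpha,
        holomorphic_on_disc f,
        forall z, open_unit_disc z -> D (f z),
        f 0 = a &
        alpha *: derive1 f 0 = v]].

Section Matrices.
Variable n : nat.
Implicit Types A B : 'M[C]_n.

Definition spectrum A : set C := [set l | eigenvalue A l].

(* For n > 0 the spectrum is finite and nonempty, so this sup is a maximum. *)
Definition spectral_radius A : R := sup (modulus @` spectrum A).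

Definition spectral_ball : set 'M[C]_n := [set A | spectral_radius A < 1].

(* Equality of the sets of eigenvalues, without multiplicities. *)
Definition isospectral_variety A : set 'M[C]_n :=
  [set X | spectral_ball X /\ spectrum X = spectrum A].

Definition tangent_cone (L : set 'M[C]_n) A : set 'M[C]_n :=
  [set B | exists (X : nat -> 'M[C]_n) (c : nat -> R),
    [/\ forall j, L (X j),
        X @ \oo --> A,
        forall j, 0 < c j &
        (fun j => ((c j)%:C : C) *: (X j - A)) @ \oo --> B]].

End Matrices.
End SpectralBall.

Arguments spectral_ball : clear implicits.

(* Main.v *)
Require Import Defs.
From mathcomp Require Import all_boot all_order all_algebra.
From mathcomp Require Import spectral complex ring lra.
From mathcomp Require Import all_classical all_reals all_analysis.
Import Order.TTheory GRing.Theory Num.Theory.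
Import numFieldNormedType.Exports.
Local Open Scope classical_set_scope.
Local Open Scope complex_scope.
Local Open Scope ring_scope.

(** First-order data give no obstruction: [tr B], [tr (A B)] and [tr (A^2 B)] all vanish. With
    [f = A + z (b B + z E)], the leading coefficients of [tr (f^2)] and [tr (f^3)] are
    [2 tr (A E) + 2 b^2] at order 2 and [3 b tr (A E)] at order 3; the latter has no term in [b^3]
    because [tr (B^3) = 0], so eliminating [tr (A E)] leaves a pure cube. The nilpotent curve cannot
    be polynomial in its natural parameter: a polynomial [X] with nilpotent values, [X(0) = A] and
    [X'(0) = B] would give the discs [X (c z)] for every [c], and the metric would vanish. Hence the
    fractional powers: in [t = s^2] the curve is [A + t B + O(t^(3/2))]. *)

(* On three distinct indices take [A = E_ji] and [B = E_ii - E_ll]. A curve of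
   nilpotent matrices through [A] with tangent [B] shows that [B] lies in the
   tangent cone. If [f] is a disc through [A] with [f'(0) = b B], the traces of
   [f^2] and [f^3] are bounded by [n], and the function
   [2 tr(f^3) / z^3 - 3 b tr(f^2) / z^2] tends to [-6 b^3] at 0: the second-order
   coefficient of [f], which is not controlled, cancels. A holomorphic function
   on a punctured disc is bounded at a limit at 0 by its supremum on any circle,
   so [6 |b|^3] is at most linear in [|b|], and [b] is bounded.
   The bound on circles comes from Goursat's theorem in the coordinates
   [z = exp (x + i t)]. *)

(** * Modulus of a complex number *)
Section Modulus.
Context {R : realType}.
Local Notation C := (Cplx R).
Implicit Types (z w : C) (x : R).

Lemma normrE_modulus z : `|z| = (modulus z)%:C :> C.
Proof. by []. Qed.

Lemma modulus_ge0 z : 0 <= modulus z.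
Proof. by case: z => a b; rewrite /modulus /= sqrtr_ge0. Qed.

Lemma modulusM z w : modulus (z * w) = modulus z * modulus w.
Proof. exact: Normc.normcM. Qed.

Lemma modulus0 : modulus (0 : C) = 0.
Proof. exact: Normc.normc0. Qed.

Lemma modulus1 : modulus (1 : C) = 1.
Proof. exact: Normc.normc1. Qed.

Lemma modulusV z : modulus z^-1 = (modulus z)^-1.
Proof. exact: Normc.normcV. Qed.

Lemma modulusN z : modulus (- z) = modulus z.
Proof. exact: normcN. Qed.

Lemma modulus_eq0 z : (modulus z == 0) = (z == 0).
Proof.
apply/eqP/eqP => [/Normc.eq0_normc//|->]; exact: modulus0.
Qed.

Lemma modulus_gt0 z : (0 < modulus z) = (z != 0).
Proof. by rewrite lt_def modulus_eq0 modulus_ge0 andbT. Qed.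

Lemma modulusX z n : modulus (z ^+ n) = modulus z ^+ n.
Proof.
elim: n => [|n ih]; first by rewrite !expr0 modulus1.
by rewrite !exprS modulusM ih.
Qed.

Lemma modulusD z w : modulus (z + w) <= modulus z + modulus w.
Proof. exact: le_normcD. Qed.

Lemma modulusB z w : modulus (z - w) <= modulus z + modulus w.
Proof. by rewrite (le_trans (modulusD _ _))// modulusN. Qed.

Lemma modulus_distrC z w : modulus (z - w) = modulus (w - z).
Proof. by rewrite -modulusN opprB. Qed.

Lemma modulus_real x : modulus (x%:C : C) = `|x|.
Proof. by rewrite /modulus /= expr0n addr0 sqrtr_sqr. Qed.

Lemma modulus_i : modulus ('i : C) = 1.
Proof. by rewrite /modulus /= expr0n add0r expr1n sqrtr1. Qed.

Lemma ge_modulus_Re z : `|complex.Re z| <= modulus z.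
Proof.
by case: z => a b; rewrite /modulus /= -sqrtr_sqr ler_wsqrtr// lerDl sqr_ge0.
Qed.

Lemma ge_modulus_Im z : `|complex.Im z| <= modulus z.
Proof.
by case: z => a b; rewrite /modulus /= -sqrtr_sqr ler_wsqrtr// lerDr sqr_ge0.
Qed.

Lemma modulus_le_ReIm z : modulus z <= `|complex.Re z| + `|complex.Im z|.
Proof.
rewrite [z]complexE (le_trans (modulusD _ _))// modulusM modulus_i mul1r.
by rewrite !modulus_real -complexE.
Qed.

End Modulus.

(** * Bisection and the mean value inequality *)
Section Bisection.
Context {R : realType}.

Lemma nested_intervals (u v : nat -> R) :
  (forall n, u n <= u n.+1) -> (forall n, v n.+1 <= v n) ->
  (forall n, u n <= v n) -> exists x, forall n, u n <= x <= v n.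
Proof.
move=> /nondecreasing_seqP uS /nonincreasing_seqP vS uv.
have uvmn m n : u m <= v n.
  have [mn|/ltnW nm] := leqP m n.
    exact: le_trans (uS _ _ mn) (uv n).
  exact: le_trans (uv m) (vS _ _ nm).
exists (sup (range u)) => n; apply/andP; split.
  apply: ub_le_sup; last by exists n.
  by exists (v 0%N) => _ [m _ <-].
by apply: ge_sup => [|_ [m _ <-]//]; exists (u 0%N), 0%N.
Qed.

(** Compactness for local-to-global estimates: an inequality that passes from four quarters to the
    whole box, yet fails on the whole, fails on arbitrarily small boxes around one point. *)
Lemma bisection2 (bad : R -> R -> R -> R -> Prop) (a b c d : R) :
  a <= b -> c <= d -> bad a b c d ->
  (forall a b c d, a <= b -> c <= d -> bad a b c d ->
    [\/ bad a ((a + b) / 2) c ((c + d) / 2), bad ((a + b) / 2) b c ((c + d) / 2),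
        bad a ((a + b) / 2) ((c + d) / 2) d | bad ((a + b) / 2) b ((c + d) / 2) d]) ->
  exists x y, [/\ a <= x <= b, c <= y <= d &
    forall e : R, 0 < e -> exists a' b' c' d',
      [/\ a <= a' /\ b' <= b, c <= c' /\ d' <= d, a' <= x <= b', c' <= y <= d' &
          [/\ b' - a' < e, d' - c' < e & bad a' b' c' d']]].
Proof.
move=> ab cd bad0 split_bad.
pose good (s : R * R * R * R) :=
  [/\ s.1.1.1 <= s.1.1.2, s.1.2 <= s.2 & bad s.1.1.1 s.1.1.2 s.1.2 s.2].
pose half (s t : R * R * R * R) :=
  [/\ s.1.1.1 <= t.1.1.1 /\ t.1.1.2 <= s.1.1.2,
      s.1.2 <= t.1.2 /\ t.2 <= s.2,
      t.1.1.2 - t.1.1.1 = (s.1.1.2 - s.1.1.1) / 2 &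
      t.2 - t.1.2 = (s.2 - s.1.2) / 2].
(* [choice] needs a total map, so a box that is not [good] is sent to an arbitrary one; the orbit
   [S] never meets such a box. *)
have /choice[f fP] : forall s, exists t, good s -> good t /\ half s t.
  move=> [[[p q] r] s]; have [[/= pq rs bs]|ngood] := pselect (good (p, q, r, s));
    last by exists (0, 0, 0, 0).
  case: (split_bad _ _ _ _ pq rs bs) => bt.
  - exists (p, (p + q) / 2, r, (r + s) / 2) => _.
    by do 2 split => //=; lra.
  - exists ((p + q) / 2, q, r, (r + s) / 2) => _.
    by do 2 split => //=; lra.
  - exists (p, (p + q) / 2, (r + s) / 2, s) => _.
    by do 2 split => //=; lra.
  - exists ((p + q) / 2, q, (r + s) / 2, s) => _.
    by do 2 split => //=; lra.
pose S n := iter n f (a, b, c, d).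
have gS n : good (S n) by elim: n => [|n ih]; [split|exact: (fP _ ih).1].
have hS n : half (S n) (S n.+1) by exact: (fP _ (gS n)).2.
have [|||x xP] := @nested_intervals (fun n => (S n).1.1.1) (fun n => (S n).1.1.2).
- by move=> n; case: (hS n) => -[].
- by move=> n; case: (hS n) => -[].
- by move=> n; case: (gS n).
have [|||y yP] := @nested_intervals (fun n => (S n).1.2) (fun n => (S n).2).
- by move=> n; case: (hS n) => _ [].
- by move=> n; case: (hS n) => _ [].
- by move=> n; case: (gS n).
have outer n : [/\ a <= (S n).1.1.1, (S n).1.1.2 <= b, c <= (S n).1.2 & (S n).2 <= d].
  elim: n => [//|n [? ? ? ?]]; case: (hS n) => -[? ?] [? ?] _ _.
  by split; [apply: le_trans; last eassumption|apply: le_trans; first eassumption|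
    apply: le_trans; last eassumption|apply: le_trans; first eassumption].
have widths n : (S n).1.1.2 - (S n).1.1.1 = (b - a) / 2 ^+ n /\
                (S n).2 - (S n).1.2 = (d - c) / 2 ^+ n.
  elim: n => [|n [ih1 ih2]]; first by rewrite expr0 !divr1.
  by case: (hS n) => _ _ -> ->; rewrite ih1 ih2 exprSr invfM !mulrA.
exists x, y; split => [||e e0]; first exact: (xP 0%N).
  exact: (yP 0%N).
have [n nP] : exists n, (b - a) / 2 ^+ n < e /\ (d - c) / 2 ^+ n < e.
  pose N := (Num.truncn (((b - a) + (d - c)) / e)).+1; exists N.
  have h : ((b - a) + (d - c)) / e < 2 ^+ N.
    apply: lt_trans (truncnS_gt _) _.
    by rewrite -natrX ltr_nat ltn_expl.
  have e2 : 0 < 2 ^+ N :> R by rewrite exprn_gt0.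
  move: h; rewrite ltr_pdivrMr// => h.
  by split; rewrite ltr_pdivrMr// mulrC (le_lt_trans _ h)//; lra.
exists (S n).1.1.1, (S n).1.1.2, (S n).1.2, (S n).2.
have [q1 q2 q3 q4] := outer n; have [w1 w2] := widths n; have [_ _ bn] := gS n.
by split; [split|split|exact: xP|exact: yP|split => //; rewrite ?w1 ?w2; tauto].
Qed.

Lemma bisection (bad : R -> R -> Prop) (a b : R) :
  a <= b -> bad a b ->
  (forall a b, a <= b -> bad a b -> bad a ((a + b) / 2) \/ bad ((a + b) / 2) b) ->
  exists2 x, a <= x <= b & forall e : R, 0 < e -> exists a' b',
    [/\ a <= a' /\ b' <= b, a' <= x <= b', b' - a' < e & bad a' b'].
Proof.
move=> ab bad0 split_bad.
(* The second interval degenerates to the point 0. *)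
have [|x [y [xab _ xP]]] :=
    @bisection2 (fun a b _ _ => bad a b) a b 0 0 ab (lexx 0) bad0.
  by move=> p q _ _ pq _ /(split_bad _ _ pq)[]; [constructor 1|constructor 2].
exists x => // e /xP[a' [b' [_ [_ [? _ ? _ [? _ ?]]]]]].
by exists a', b'.
Qed.

End Bisection.

Section RealVariable.
Context {R : realType}.
Local Notation C := (Cplx R).
Implicit Types (P Q : R -> C) (t : R) (D : C).

(** The error bound is non-strict and free of quotients: it includes [s = t], and such estimates
    simply add up. *)
Definition has_rderiv P t D := forall e : R, 0 < e -> exists2 d : R, 0 < d &
  forall s, `|s - t| < d ->
    modulus (P s - P t - D * (s - t)%:C) <= e * `|s - t|.

Lemma has_rderivB P Q t D E :
  has_rderiv P t D -> has_rderiv Q t E -> has_rderiv (P \- Q) t (D - E).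
Proof.
move=> dP dQ e e0; have e2 : 0 < e / 2 by rewrite divr_gt0.
have [d1 d10 P1] := dP _ e2; have [d2 d20 Q1] := dQ _ e2.
exists (Num.min d1 d2) => [|s]; first by rewrite lt_min d10.
rewrite lt_min => /andP[/P1 sP /Q1 sQ].
have -> : (P \- Q) s - (P \- Q) t - (D - E) * (s - t)%:C =
  (P s - P t - D * (s - t)%:C) - (Q s - Q t - E * (s - t)%:C) by rewrite /=; ring.
by apply: le_trans (modulusB _ _) _; lra.
Qed.

(** The affine models in Goursat's theorem, restricted to a line, have primitives of this form. *)
Lemma has_rderiv_quadratic (p q : C) (u t : R) :
  has_rderiv (fun s => p * s%:C + q * ((s - u)%:C ^+ 2 / 2)) t (p + q * (t - u)%:C).
Proof.
move=> e e0; exists (e / (modulus q + 1)).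
  by rewrite divr_gt0// ltr_wpDl// modulus_ge0.
move=> s; rewrite ltr_pdivlMr; last by rewrite ltr_wpDl// modulus_ge0.
move=> se.
have -> : p * s%:C + q * ((s - u)%:C ^+ 2 / 2) - (p * t%:C + q * ((t - u)%:C ^+ 2 / 2)) -
    (p + q * (t - u)%:C) * (s - t)%:C = q * ((s - t) ^+ 2 / 2)%:C :> C.
  by field.
rewrite modulusM modulus_real normrM normrX.
rewrite (_ : `|2^-1| = 2^-1 :> R); last by rewrite ger0_norm.
move: se; have := normr_ge0 (s - t); have := modulus_ge0 q.
set m := modulus q; set n := `|s - t| => m0 n0 h.
have : 0 <= (e - n * (m + 1)) * n by rewrite mulr_ge0// subr_ge0 ltW.
nra.
Qed.

(** Complex values admit no intermediate point with equality. Failure of the inequality is instead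
    bisected down to a point, where the derivative bound contradicts it. *)
Lemma rmean_value_inequality P (a b K : R) : a <= b ->
  (forall t, a <= t <= b -> exists2 D, has_rderiv P t D & modulus D <= K) ->
  modulus (P b - P a) <= K * (b - a).
Proof.
move=> ab dP; rewrite leNgt; apply/negP => lt_ab.
(* The slack [e] absorbs the error of the linear approximation at the limit point; the [+ 1] in the
   denominator covers [a = b]. *)
have [e e0 e_ab] : exists2 e, 0 < e & (K + e) * (b - a) < modulus (P b - P a).
  exists ((modulus (P b - P a) - K * (b - a)) / (2 * (b - a + 1))).
    by rewrite divr_gt0 ?subr_gt0// mulr_gt0//; lra.
  set N := modulus _ in lt_ab *.
  rewrite mulrDl -ltrBrDl mulrAC ltr_pdivrMr; last by rewrite mulr_gt0//; lra.
  nra.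
have [|x xab xP] := @bisection R
  (fun p q => (K + e) * (q - p) < modulus (P q - P p)) a b ab e_ab.
  move=> p q pq bad; apply/orP; rewrite -implyNb -leNgt; apply/implyP => h.
  rewrite ltNge; apply/negP => h'; move: bad; apply/negP; rewrite -leNgt.
  rewrite (_ : P q - P p = (P q - P ((p + q) / 2)) + (P ((p + q) / 2) - P p));
    last by ring.
  by apply: le_trans (modulusD _ _) _; lra.
have [D dD DK] := dP _ xab; have [d d0 dxP] := dD _ e0.
have [p [q [_ /andP[px xq] pqd bad]]] := xP _ d0.
have hp : `|p - x| = x - p by rewrite ler0_norm ?opprB ?subr_le0.
have hq : `|q - x| = q - x by rewrite ger0_norm ?subr_ge0.
have bp := dxP p; have bq := dxP q; rewrite hp in bp; rewrite hq in bq.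
have {}bp := bp ltac:(lra); have {}bq := bq ltac:(lra).
move: bad; apply/negP; rewrite -leNgt.
have -> : P q - P p = (P q - P x - D * (q - x)%:C) - (P p - P x - D * (p - x)%:C)
    + D * (q - p)%:C by ring.
apply: le_trans (modulusD _ _) _; rewrite modulusM modulus_real.
have -> : `|q - p| = q - p by rewrite ger0_norm//; lra.
have := modulusB (P q - P x - D * (q - x)%:C) (P p - P x - D * (p - x)%:C).
have : modulus D * (q - p) <= K * (q - p) by rewrite ler_wpM2r//; lra.
nra.
Qed.

End RealVariable.

(** * Goursat's theorem *)
Section Goursat.
Context {R : realType}.
Local Notation C := (Cplx R).

(* [PV x] and [PH y] are primitives of [G] along vertical and horizontal lines,
   so the conclusion says that the integral of [G] over the boundary of the
   rectangle vanishes. *)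
Lemma goursat (G PV PH : R -> R -> C) (a b c d : R) : a <= b -> c <= d ->
  (forall x y, a <= x <= b -> c <= y <= d -> has_rderiv (PV x) y (G x y)) ->
  (forall x y, a <= x <= b -> c <= y <= d -> has_rderiv (PH y) x (G x y)) ->
  (forall x y, a <= x <= b -> c <= y <= d -> exists D : C,
    forall e : R, 0 < e -> exists2 r : R, 0 < r & forall x' y',
      a <= x' <= b -> c <= y' <= d -> `|x' - x| < r -> `|y' - y| < r ->
      modulus (G x' y' - G x y - D * ((x' - x)%:C + 'i * (y' - y)%:C))
        <= e * (`|x' - x| + `|y' - y|)) ->
  'i * ((PV b d - PV b c) - (PV a d - PV a c)) =
  (PH d b - PH d a) - (PH c b - PH c a).
Proof.
move=> ab cd dPV dPH dG.
(* [J] is the defect of the claim. It is additive under subdivision, while the threshold chosen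
   below is divided by 4 when both sides are halved. *)
pose J a b c d : C := 'i * ((PV b d - PV b c) - (PV a d - PV a c)) -
  ((PH d b - PH d a) - (PH c b - PH c a)).
apply/eqP; rewrite -subr_eq0; apply/negPn/negP => J0.
have {}J0 : 0 < modulus (J a b c d) by rewrite modulus_gt0.
have [e e0 eJ] : exists2 e, 0 < e &
    2 * e * ((b - a) + (d - c)) ^+ 2 < modulus (J a b c d).
  set S := ((b - a) + (d - c)) ^+ 2; have S0 : 0 <= S by exact: sqr_ge0.
  exists (modulus (J a b c d) / (4 * (S + 1))); first by rewrite divr_gt0//; lra.
  move: J0; set K := modulus _ => J0.
  rewrite (_ : 2 * (K / (4 * (S + 1))) * S = K * (2 * S) / (4 * (S + 1))); last by ring.
  rewrite ltr_pdivrMr; last by lra.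
  nra.
have [|x [y [xab ycd xyP]]] := @bisection2 R (fun a b c d =>
  2 * e * ((b - a) + (d - c)) ^+ 2 < modulus (J a b c d)) a b c d ab cd eJ.
  move=> p q r s pq rs bad.
  set m := (p + q) / 2; set n := (r + s) / 2.
  have JE : J p q r s = (J p m r n + J m q r n) + (J p m n s + J m q n s).
    by rewrite /J; ring.
  have := le_trans (modulusD (J p m r n + J m q r n) (J p m n s + J m q n s))
    (lerD (modulusD _ _) (modulusD _ _)).
  rewrite -JE => le4.
  case: (ltP _ (modulus (J p m r n))) => [|h1]; first by constructor 1.
  case: (ltP _ (modulus (J m q r n))) => [|h2]; first by constructor 2.
  case: (ltP _ (modulus (J p m n s))) => [|h3]; first by constructor 3.
  case: (ltP _ (modulus (J m q n s))) => [|h4]; first by constructor 4.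
  exfalso; move: h1 h2 h3 h4.
  have -> : m - p = (q - p) / 2 by rewrite /m; field.
  have -> : q - m = (q - p) / 2 by rewrite /m; field.
  have -> : n - r = (s - r) / 2 by rewrite /n; field.
  have -> : s - n = (s - r) / 2 by rewrite /n; field.
  rewrite -mulrDl expr_div_n; lra.
have [D dD] := dG _ _ xab ycd; have [r r0 rP] := dD _ e0.
have [p [q [s [t [[ap qb] [cs td] pxq syt [qpr tsr bad]]]]]] := xyP _ r0.
have G_approx x' y' : p <= x' <= q -> s <= y' <= t ->
    modulus (G x' y' - (G x y + D * ((x' - x)%:C + 'i * (y' - y)%:C)))
      <= e * ((q - p) + (t - s)).
  move=> x'P y'P.
  have x'd : `|x' - x| <= q - p by rewrite ler_norml; apply/andP; split; lra.
  have y'd : `|y' - y| <= t - s by rewrite ler_norml; apply/andP; split; lra.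
  rewrite opprD addrA; apply: le_trans (rP _ _ _ _ _ _) _; try lra.
  by apply: ler_wpM2l; [exact: ltW|exact: lerD].
(* Primitives of the affine model of [G] at [(x, y)]. Their boundary integral vanishes identically,
   so [J] sees only the approximation error, at most [e * S] on each side; the sides have total
   length [2 * S]. *)
pose QV u (v : R) : C :=
  (G x y + D * (u - x)%:C) * v%:C + (D * 'i) * ((v - y)%:C ^+ 2 / 2).
pose QH v (u : R) : C :=
  (G x y + D * 'i * (v - y)%:C) * u%:C + D * ((u - x)%:C ^+ 2 / 2).
pose S := (q - p) + (t - s).
have EV u : p <= u <= q ->
    modulus ((PV u \- QV u) t - (PV u \- QV u) s) <= e * S * (t - s).
  move=> upq; apply: rmean_value_inequality; first lra.
  move=> v vst; eexists.
    by apply: has_rderivB; [apply: dPV; lra|exact: has_rderiv_quadratic].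
  apply: le_trans (G_approx u v upq vst); rewrite le_eqVlt; apply/orP; left.
  by apply/eqP; congr modulus; ring.
have EH v : s <= v <= t ->
    modulus ((PH v \- QH v) q - (PH v \- QH v) p) <= e * S * (q - p).
  move=> vst; apply: rmean_value_inequality; first lra.
  move=> u upq; eexists.
    by apply: has_rderivB; [apply: dPH; lra|exact: has_rderiv_quadratic].
  apply: le_trans (G_approx u v upq vst); rewrite le_eqVlt; apply/orP; left.
  by apply/eqP; congr modulus; ring.
move: bad; apply/negP; rewrite -leNgt.
have -> : J p q s t =
    'i * (((PV q \- QV q) t - (PV q \- QV q) s) - ((PV p \- QV p) t - (PV p \- QV p) s))
    - (((PH t \- QH t) q - (PH t \- QH t) p) - ((PH s \- QH s) q - (PH s \- QH s) p)).
  by rewrite /J /QV /QH /=; ring.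
apply: le_trans (modulusB _ _) _; rewrite modulusM modulus_i mul1r.
apply: le_trans (lerD (modulusB _ _) (modulusB _ _)) _.
apply: le_trans (lerD (lerD (EV q _) (EV p _)) (lerD (EH t _) (EH s _))) _; try lra.
by rewrite le_eqVlt; apply/orP; left; apply/eqP; rewrite /S; ring.
Qed.

End Goursat.

(** * Primitives of continuous functions of a real variable *)

Section Primitive.
Context {R : realType}.
Local Notation C := (Cplx R).
Notation mu := (@lebesgue_measure R).

(** The integral from [a], differentiated by the fundamental theorem at interior points only; later
    applications therefore enlarge their intervals. *)
Lemma real_primitive (g : R -> R) (a b : R) : a < b ->
  (forall t, a <= t <= b -> {for t, continuous g}) ->
  exists P : R -> R, forall t, a < t < b -> is_derive (t : R) (1 : R) P (g t).
Proof.
move=> ab cg.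
have ig : mu.-integrable `[a, b] (EFin \o g).
  apply: continuous_compact_integrable; first exact: segment_compact.
  by apply: continuous_in_subspaceT => x; rewrite inE /= in_itv /=; exact: cg.
exists (fun x => (\int[mu]_(t in `[a, x]) g t)%R) => t /andP[at_ tb].
have [] := @continuous_FTC1_closed R g a t b tb ig at_.
  by apply: cg; rewrite !ltW.
by rewrite derive1E => d1 d2; exact: DeriveDef.
Qed.

Lemma is_derive_bound (P : R -> R) (t D : R) :
  is_derive (t : R) (1 : R) P D -> forall e : R, 0 < e ->
  exists2 d : R, 0 < d & forall s, `|s - t| < d ->
    `|P s - P t - D * (s - t)| <= e * `|s - t|.
Proof.
move=> [dP DE] e e0.
have : (fun h => h^-1 *: (P (h *: 1 + t) - P t)) @ 0^' --> D.
  by rewrite -DE; exact: dP.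
move/cvgrPdist_le => /(_ e e0); rewrite near_withinE.
move=> [d /= d0 dP']; exists d => // s sd.
have [->|st] := eqVneq s t; first by rewrite !subrr mulr0 subrr normr0 mulr0.
have := dP' (s - t); rewrite /ball_ /= sub0r normrN subr_eq0 => /(_ sd st).
rewrite -mulr_algl /= -[_ *: 1]/(_ * 1) !mulr1 subrK -[_ *: (P s - _)]/(_ * _) => h.
rewrite distrC (_ : D * _ - _ = (D - (s - t)^-1 * (P s - P t)) * (s - t)).
  by rewrite normrM ler_wpM2r.
by rewrite mulrBl mulrAC mulVf ?mul1r ?subr_eq0.
Qed.

Lemma is_derive_has_rderiv (P1 P2 : R -> R) (t D1 D2 : R) :
  is_derive (t : R) (1 : R) P1 D1 -> is_derive (t : R) (1 : R) P2 D2 ->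
  has_rderiv (fun s => (P1 s +i* P2 s : C)) t (D1 +i* D2).
Proof.
move=> /is_derive_bound d1 /is_derive_bound d2 e e0.
have e2 : 0 < e / 2 by rewrite divr_gt0.
have [r1 r10 h1] := d1 _ e2; have [r2 r20 h2] := d2 _ e2.
exists (Num.min r1 r2) => [|s]; first by rewrite lt_min r10.
rewrite lt_min => /andP[/h1 {}h1 /h2 {}h2].
apply: le_trans (modulus_le_ReIm _) _; rewrite /= !(mulr0, subr0, add0r, addr0).
lra.
Qed.

Lemma complex_primitive (g : R -> C) (a b : R) : a < b ->
  (forall t, a <= t <= b -> forall e : R, 0 < e -> exists2 d : R, 0 < d &
     forall s, `|s - t| < d -> modulus (g s - g t) <= e) ->
  exists P : R -> C, forall t, a < t < b -> has_rderiv P t (g t).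
Proof.
move=> ab cg.
have [|P1 dP1] := @real_primitive (fun s => complex.Re (g s)) a b ab.
- move=> t /cg{}cg; apply/cvgrPdist_le => e e0; have [d d0 dg] := cg _ e0.
  exists d => // s /=; rewrite distrC => /dg; apply: le_trans.
  apply: le_trans (ge_modulus_Re _); rewrite distrC.
  by case: (g s) => u1 u2; case: (g t).
have [|P2 dP2] := @real_primitive (fun s => complex.Im (g s)) a b ab.
- move=> t /cg{}cg; apply/cvgrPdist_le => e e0; have [d d0 dg] := cg _ e0.
  exists d => // s /=; rewrite distrC => /dg; apply: le_trans.
  apply: le_trans (ge_modulus_Im _); rewrite distrC.
  by case: (g s) => ? ?; case: (g t).
exists (fun s => P1 s +i* P2 s) => t tab.
have := is_derive_has_rderiv _ _ _ _ _ (dP1 _ tab) (dP2 _ tab).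
by rewrite /=; case: (g t).
Qed.

End Primitive.

(** * Polar coordinates and complex derivatives *)
Section Polar.
Context {R : realType}.
Local Notation C := (Cplx R).

(** The exponential of [x + i t] through real functions: coordinates in which circles around 0
    become vertical lines. *)
Definition cexp (x t : R) : C := (expR x)%:C * (cos t +i* sin t).

Lemma modulus_cis t : modulus (cos t +i* sin t : C) = 1.
Proof. by rewrite /modulus /= cos2Dsin2 sqrtr1. Qed.

Lemma modulus_cexp x t : modulus (cexp x t) = expR x.
Proof.
by rewrite /cexp modulusM modulus_cis mulr1 modulus_real ger0_norm// expR_ge0.
Qed.

Lemma cexpD x y t s : cexp (x + y) (t + s) = cexp x t * cexp y s.
Proof.
rewrite /cexp expRD cosD sinD mulrACA -rmorphM; congr (_ * _).
by rewrite [sin t * _ + _]addrC.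
Qed.

Lemma cexp_2pi x : cexp x (2 * pi) = cexp x 0.
Proof. by rewrite /cexp mulr_natl cos2pi sin2pi cos0 sin0. Qed.

Lemma cexp_approx (e : R) : 0 < e -> exists2 d : R, 0 < d & forall h l,
  `|h| < d -> `|l| < d ->
  modulus (cexp h l - 1 - (h%:C + 'i * l%:C)) <= e * (`|h| + `|l|).
Proof.
move=> e0; have [e' [e'0 e'1 e'e]] : exists e' : R, [/\ 0 < e', e' <= 1 & e' <= e / 4].
  by exists (Num.min (e / 4) 1); rewrite lt_min divr_gt0//= !ge_min !lexx orbT.
have [d1 d10 h1] := is_derive_bound _ _ _ (is_derive_expR (0 : R) ) _ e'0.
have [d2 d20 h2] := is_derive_bound _ _ _ (is_derive_cos (0 : R) ) _ e'0.
have [d3 d30 h3] := is_derive_bound _ _ _ (is_derive_sin (0 : R) ) _ e'0.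
exists (Num.min (Num.min d1 d2) (Num.min d3 (e / 16))).
  by rewrite !lt_min d10 d20 d30 divr_gt0.
move=> h l; rewrite !lt_min => /andP[/andP[hd1 _] /andP[_ he]].
move=> /andP[/andP[_ ld2] /andP[ld3 le]].
have := h1 h; have := h2 l; have := h3 l; rewrite !subr0.
rewrite expR0 cos0 sin0 oppr0 mul0r mul1r !subr0 addr0 mul1r.
move=> /(_ ld3) s3 /(_ ld2) s2 /(_ hd1) s1.
(* The remainder splits into those of [expR h] and of [v], plus the product [(expR h - 1) * v]. This
   product is quadratic, and [|l| < e / 16] makes it small. *)
pose v : C := cos l +i* sin l - 1.
have vE : v - 'i * l%:C = (cos l - 1) +i* (sin l - l).
  by apply/eqP; rewrite /v eq_complex /=; apply/andP; split; apply/eqP; ring.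
have vle : modulus (v - 'i * l%:C) <= 2 * e' * `|l|.
  by rewrite vE; apply: le_trans (modulus_le_ReIm _) _; rewrite /=; lra.
have vle' : modulus v <= 3 * `|l|.
  rewrite -(subrK ('i * l%:C) v); apply: le_trans (modulusD _ _) _.
  rewrite modulusM modulus_i mul1r modulus_real.
  have : e' * `|l| <= 1 * `|l| by rewrite ler_wpM2r.
  lra.
have ule : `|expR h - 1| <= 2 * `|h|.
  rewrite -(subrK h (expR h - 1)); apply: le_trans (ler_normD _ _) _.
  have : e' * `|h| <= 1 * `|h| by rewrite ler_wpM2r.
  lra.
have -> : cexp h l - 1 - (h%:C + 'i * l%:C) =
    (expR h - 1 - h)%:C + (v - 'i * l%:C) + (expR h - 1)%:C * v.
  by rewrite /v /cexp; ring.
apply: le_trans (modulusD _ _) _.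
apply: le_trans (lerD (modulusD _ _) (lexx _)) _; rewrite modulusM !modulus_real.
have p1 : `|expR h - 1| * modulus v <= (2 * `|h|) * (3 * `|l|).
  by rewrite ler_pM// modulus_ge0.
have p2 : `|h| * `|l| <= `|h| * (e / 16) by rewrite ler_wpM2l// ltW.
have p3 : e' * `|h| <= e / 4 * `|h| by rewrite ler_wpM2r.
have p4 : e' * `|l| <= e / 4 * `|l| by rewrite ler_wpM2r.
have p5 : 0 <= e * `|h| by rewrite mulr_ge0// ltW.
have p6 : 0 <= e * `|l| by rewrite mulr_ge0// ltW.
lra.
Qed.

End Polar.

Section ComplexDerivative.
Context {R : realType}.
Local Notation C := (Cplx R).
Implicit Types (f g k : C -> C) (z w D : C).

(** Positive elements of [C] are real by definition of the order; radii of the topology on [C] thus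
    become real radii. *)
Lemma gt0_realC (e : C) : 0 < e -> exists2 r : R, 0 < r & e = r%:C.
Proof.
move=> e0; have /ger0_Im Im0 : 0 <= (e : R[i]) by exact: ltW.
exists (complex.Re e); last by case: e Im0 {e0} => a b /= ->.
by move: e0; rewrite ltcE => /andP[].
Qed.

Lemma dnbhs0_modulusP (P : C -> Prop) :
  (\forall h \near (0 : C)^', P h) <->
  exists2 d : R, 0 < d & forall h, h != 0 -> modulus h < d -> P h.
Proof.
rewrite near_withinE; split=> [[d /= /gt0_realC[r r0 ->] dP]|[d d0 dP]].
  exists r => // h h0 hr; apply: dP => //.
  by rewrite /ball_ /= sub0r normrN normrE_modulus ltcR.
exists d%:C => /=; first by rewrite ltcR.
move=> h; rewrite /ball_ /= sub0r normrN normrE_modulus ltcR => hd h0.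
exact: dP.
Qed.

Definition has_cderiv f z D := forall e : R, 0 < e -> exists2 d : R, 0 < d &
  forall h, modulus h < d -> modulus (f (z + h) - f z - D * h) <= e * modulus h.

Lemma cvg_cderivP f z D :
  (fun h => h^-1 *: (f (h *: 1 + z) - f z)) @ 0^' --> D <-> has_cderiv f z D.
Proof.
split=> [/cvgrPdist_le fD e e0|fD].
  have /fD/dnbhs0_modulusP[d d0 dP] : 0 < e%:C :> C by rewrite ltcR.
  exists d => // h hd; have [->|h0] := eqVneq h 0.
    by rewrite addr0 subrr mulr0 subrr !modulus0 mulr0.
  have := dP h h0 hd; rewrite normrE_modulus lecR.
  rewrite -[h *: 1]/(h * 1) mulr1 -[_ *: (_ - _)]/(_ * (_ - _)) => {}dP.
  rewrite modulus_distrC (_ : D * h - _ = (D - h^-1 * (f (h + z) - f z)) * h).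
    by rewrite modulusM ler_wpM2r// modulus_ge0.
  by rewrite mulrBl mulrAC mulVf// mul1r (addrC h).
apply/cvgrPdist_le => e /gt0_realC[r r0 ->]; apply/dnbhs0_modulusP.
have [d d0 dP] := fD _ r0; exists d => // h h0 hd.
rewrite normrE_modulus lecR -[h *: 1]/(h * 1) mulr1.
rewrite -[_ *: (_ - _)]/(_ * (_ - _)).
have h0' : 0 < modulus h by rewrite modulus_gt0.
rewrite -(ler_pM2r h0') -modulusM mulrBl mulrAC mulVf// mul1r.
by rewrite modulus_distrC (addrC h); exact: dP.
Qed.

Lemma derivable_has_cderiv f z : derivable f z 1 -> has_cderiv f z (derive1 f z).
Proof. by move=> df; apply/cvg_cderivP; rewrite derive1E; exact: df. Qed.

Lemma has_cderiv_derivable f z D : has_cderiv f z D -> derivable f z 1.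
Proof. by move=> /cvg_cderivP df; apply/cvg_ex; exists D. Qed.

Lemma has_cderiv_derive1 f z D : has_cderiv f z D -> derive1 f z = D.
Proof. by move=> /cvg_cderivP df; rewrite derive1E; apply/cvg_lim. Qed.

(** Chain rule for [k \o cexp], in the form that Goursat's theorem asks for. The addition law
    reduces the exponential near [(x, t)] to its expansion at the origin, so [D] is the derivative
    of [k] times [cexp x t]. *)
Lemma derivable_cexp k (x t : R) : derivable k (cexp x t) 1 -> exists D : C,
  forall e : R, 0 < e -> exists2 r : R, 0 < r & forall x' t',
    `|x' - x| < r -> `|t' - t| < r ->
    modulus (k (cexp x' t') - k (cexp x t) - D * ((x' - x)%:C + 'i * (t' - t)%:C))
      <= e * (`|x' - x| + `|t' - t|).
Proof.
move=> /derivable_has_cderiv; set D := derive1 _ _ => kD.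
set z := cexp x t; exists (D * z) => e e0.
set m := modulus z; set n := modulus D.
have m0 : 0 <= m by exact: modulus_ge0.
have n0 : 0 <= n by exact: modulus_ge0.
(* Half of [e] goes to the error of [k], over an increment of size at most [2 * m * s]; the other
   half goes, through [e2], to the error of the exponential multiplied by [n * m]. *)
have [a a0 aE] : exists2 a : R, 0 < a & a * (2 * m + 1) = e / 2.
  have p0 : 0 < 2 * m + 1 by lra.
  by exists (e / 2 / (2 * m + 1)); rewrite ?divr_gt0// divfK// lt0r_neq0.
have [d d0 dP] := kD _ a0.
have [e2 [e20 e2le1 e2le]] : exists e2 : R, [/\ 0 < e2, e2 <= 1 & n * (m * e2) <= e / 2].
  have p0 : 0 < 2 * (n * m + 1) by have := mulr_ge0 n0 m0; lra.
  exists (Num.min (e / (2 * (n * m + 1))) 1).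
  rewrite lt_min divr_gt0//= !ge_min lexx orbT; split => //.
  set q := Num.min _ _.
  have : q <= e / (2 * (n * m + 1)) by rewrite ge_min lexx.
  have : 0 <= q by rewrite le_min ler01 andbT divr_ge0 ?ltW.
  by rewrite ler_pdivlMr//; nra.
have [r r0 rP] := cexp_approx _ e20.
exists (Num.min r (d / (4 * (m + 1)))); first by rewrite lt_min r0 divr_gt0//; lra.
move=> x' t'; rewrite !lt_min => /andP[xr xd] /andP[tr td].
pose c : C := cexp (x' - x) (t' - t); pose h : C := (x' - x)%:C + 'i * (t' - t)%:C.
have xE : cexp x' t' = z * c by rewrite -cexpD !subrKC.
have := rP _ _ xr tr; rewrite -/c -/h.
set s := `|_| + `|_| => cP.
have s0 : 0 <= s by rewrite addr_ge0.
have hs : modulus h <= s.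
  rewrite /h; apply: le_trans (modulusD _ _) _.
  by rewrite modulusM modulus_i mul1r !modulus_real.
pose w := z * (c - 1).
have wle : modulus w <= m * (2 * s).
  rewrite modulusM ler_wpM2l// -(subrK h (c - 1)).
  apply: le_trans (modulusD _ _) _.
  have : e2 * s <= 1 * s by rewrite ler_wpM2r.
  lra.
have wd : modulus w < d.
  apply: le_lt_trans wle _; move: xd td; rewrite !ltr_pdivlMr; try lra.
  rewrite /s; have := normr_ge0 (x' - x); have := normr_ge0 (t' - t); nra.
have := dP w wd; rewrite xE (_ : z + w = z * c); last by rewrite /w; ring.
set kw := k (z * c) - k z => kP.
rewrite (_ : kw - D * z * h = (kw - D * w) + D * (z * (c - 1 - h)));
  last by rewrite /w; ring.
apply: le_trans (modulusD _ _) _; rewrite (modulusM D) (modulusM z) -/n -/m.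
have : a * modulus w <= e / 2 * s.
  by rewrite -aE -mulrA; apply: ler_wpM2l; [exact: ltW|lra].
have : n * (m * modulus (c - 1 - h)) <= n * (m * (e2 * s)) by rewrite !ler_wpM2l.
have : n * (m * e2) * s <= e / 2 * s by rewrite ler_wpM2r.
lra.
Qed.

End ComplexDerivative.

(** * Means over circles *)
Section CircleBound.
Context {R : realType}.
Local Notation C := (Cplx R).

(** Already with error constant 1, a total derivative bounds the increment of [G] by [modulus D + 1]
    times that of the coordinates. *)
Lemma total_derivative_bound (G : R -> R -> C) (x t : R) (D : C) (r : R) : 0 < r ->
  (forall x' t', `|x' - x| < r -> `|t' - t| < r ->
    modulus (G x' t' - G x t - D * ((x' - x)%:C + 'i * (t' - t)%:C))
      <= `|x' - x| + `|t' - t|) ->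
  forall e : R, 0 < e -> exists2 d : R, 0 < d & forall x' t',
    `|x' - x| < d -> `|t' - t| < d -> modulus (G x' t' - G x t) <= e.
Proof.
move=> r0 GD e e0; set n := modulus D; have n0 : 0 <= n by exact: modulus_ge0.
exists (Num.min r (e / (2 * (n + 1)))); first by rewrite lt_min r0 divr_gt0//; lra.
move=> x' t'; rewrite !lt_min => /andP[xr xd] /andP[tr td].
pose h : C := (x' - x)%:C + 'i * (t' - t)%:C.
have hs : modulus h <= `|x' - x| + `|t' - t|.
  rewrite /h; apply: le_trans (modulusD _ _) _.
  by rewrite modulusM modulus_i mul1r !modulus_real.
have := GD _ _ xr tr; rewrite -/h => GDh.
rewrite -(subrK (D * h) (_ - _)); apply: le_trans (modulusD _ _) _.
rewrite modulusM -/n; move: xd td; rewrite !ltr_pdivlMr; try lra.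
have : n * modulus h <= n * (`|x' - x| + `|t' - t|) by rewrite ler_wpM2l.
lra.
Qed.

Lemma has_rderiv_linear (p : C) (t : R) : has_rderiv (fun s => p * s%:C) t p.
Proof.
move=> e e0; exists 1 => // s _.
have -> : p * s%:C - p * t%:C - p * (s - t)%:C = 0 by ring.
by rewrite modulus0 mulr_ge0// ltW.
Qed.

(* Goursat's theorem for [k \o cexp] on a rectangle of height [2 * pi], whose
   horizontal sides cancel, shows that the mean of [k] over a circle does not
   depend on the radius; letting the radius tend to 0 this mean tends to [L]. *)
Lemma circle_bound (k : C -> C) (rho r M : R) (L : C) : 0 < r < rho ->
  (forall z, 0 < modulus z < rho -> derivable k z 1) ->
  (forall e : R, 0 < e -> exists2 d : R, 0 < d &
    forall z, 0 < modulus z < d -> modulus (k z - L) <= e) ->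
  (forall z, modulus z = r -> modulus (k z) <= M) ->
  modulus L <= M.
Proof.
move=> /andP[r0 rrho] dk k0 kM; rewrite leNgt; apply/negP => ML.
have [d d0 dP] := k0 ((modulus L - M) / 2) ltac:(lra).
have rho0 : 0 < rho by exact: lt_trans rrho.
pose b := ln r; have br : expR b = r by rewrite lnK ?posrE.
(* A radius strictly between [r] and [rho], so that [b] is interior to the interval of the
   horizontal primitives. *)
pose b' := ln ((r + rho) / 2).
have b'r : expR b' = (r + rho) / 2 by rewrite lnK// posrE; lra.
have bb' : b < b' by rewrite -ltr_expR br b'r; lra.
pose a := Num.min b (ln (d / 2)).
have ab : a <= b by rewrite ge_min lexx.
have ad : expR a < d.
  apply: (@le_lt_trans _ _ (d / 2)); last lra.
  rewrite -[leRHS]lnK ?posrE ?divr_gt0// ler_expR.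
  by rewrite ge_min lexx orbT.
pose G x t := k (cexp x t).
have dG x t : x <= b' -> exists D : C,
    forall e : R, 0 < e -> exists2 r : R, 0 < r & forall x' t',
      `|x' - x| < r -> `|t' - t| < r ->
      modulus (G x' t' - G x t - D * ((x' - x)%:C + 'i * (t' - t)%:C))
        <= e * (`|x' - x| + `|t' - t|).
  move=> xb'; apply: derivable_cexp; apply: dk; rewrite modulus_cexp expR_gt0/=.
  by apply: (@le_lt_trans _ _ (expR b')); rewrite ?ler_expR// b'r; lra.
have cG x t : x <= b' -> forall e : R, 0 < e -> exists2 d : R, 0 < d &
    forall x' t', `|x' - x| < d -> `|t' - t| < d -> modulus (G x' t' - G x t) <= e.
  move=> /(dG x t)[D /(_ 1 ltr01)[s s0 sP]].
  apply: (@total_derivative_bound _ _ _ D s) => // x' t' ? ?.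
  by rewrite -[leRHS]mul1r; exact: sP.
have /choice[PV PVP] : forall x, exists P : R -> C, x <= b' ->
    forall t, -1 < t < 2 * pi + 1 -> has_rderiv P t (G x t).
  move=> x; have [xb'|] := leP x b'; last by exists (fun=> 0).
  have [||P PP] := @complex_primitive R (G x) (-1) (2 * pi + 1).
  - by have := pi_gt0 R; lra.
  - move=> t _ e /(cG x t xb')[s s0 sP]; exists s => // t'; apply: sP.
    by rewrite subrr normr0.
  by exists P.
(* The primitive is chosen as a function of the integrand alone. Since [cexp] has period [2 * pi] in
   [t], [PH (2 * pi)] and [PH 0] are then the same function, with no appeal to uniqueness of
   primitives. *)
have /choice[prim primP] : forall g : R -> C, exists P : R -> C,
    (forall t, a - 1 <= t <= b' -> forall e : R, 0 < e -> exists2 d : R, 0 < d &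
      forall s, `|s - t| < d -> modulus (g s - g t) <= e) ->
    forall t, a - 1 < t < b' -> has_rderiv P t (g t).
  move=> g; have [cg|ncg] := pselect (forall t, a - 1 <= t <= b' ->
    forall e : R, 0 < e -> exists2 d : R, 0 < d &
      forall s, `|s - t| < d -> modulus (g s - g t) <= e); last by exists g.
  by have [|P PP] := @complex_primitive R g (a - 1) b' _ cg; [lra|exists P].
pose PH t := prim (fun x => G x t).
have PHP t x : a - 1 < x < b' -> has_rderiv (PH t) x (G x t).
  apply: primP => {}x /andP[_ xb'] e /(cG x t xb')[s s0 sP].
  by exists s => // x' x's; apply: sP; rewrite // subrr normr0.
have PH2pi : PH (2 * pi) = PH 0.
  by congr prim; apply/funext => x; rewrite /G cexp_2pi.
have pi0 : 0 < pi :> R by exact: pi_gt0.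
have := @goursat R G PV PH a b 0 (2 * pi) ab ltac:(lra).
rewrite PH2pi subrr => eqPV.
have {}eqPV : PV b (2 * pi) - PV b 0 = PV a (2 * pi) - PV a 0.
  apply/eqP; rewrite -subr_eq0; apply/eqP.
  have i0 : ('i : C) != 0 by rewrite -modulus_eq0 modulus_i oner_eq0.
  apply: (mulfI i0); rewrite mulr0; apply: eqPV.
  - by move=> x y xab y2pi; apply: PVP; lra.
  - by move=> x y xab y2pi; apply: PHP; lra.
  move=> x y xab y2pi; have [|D DP] := dG x y; first lra.
  exists D => e /DP[s s0 sP]; exists s => // x' y' _ _; exact: sP.
have le1 : modulus (PV b (2 * pi) - PV b 0) <= M * (2 * pi - 0).
  apply: rmean_value_inequality; first lra.
  move=> t tpi; exists (G b t); first by apply: PVP; lra.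
  by apply: kM; rewrite modulus_cexp.
(* On the small circle the integrand differs from [L] by at most [(modulus L - M) / 2]. Dividing by
   [2 * pi], the two bounds give [modulus L <= M + (modulus L - M) / 2], against [M < modulus L]. *)
pose Q := PV a \- (fun s => L * s%:C).
have le2 : modulus (Q (2 * pi) - Q 0) <= (modulus L - M) / 2 * (2 * pi - 0).
  apply: rmean_value_inequality; first lra.
  move=> t tpi; exists (G a t - L); last by apply: dP; rewrite modulus_cexp expR_gt0.
  by apply: has_rderivB; [apply: PVP; lra|exact: has_rderiv_linear].
have QE : L * (2 * pi)%:C = (PV b (2 * pi) - PV b 0) - (Q (2 * pi) - Q 0).
  by rewrite eqPV /Q /=; ring.
have := modulusB (PV b (2 * pi) - PV b 0) (Q (2 * pi) - Q 0).
rewrite -QE modulusM modulus_real (_ : `|2 * pi| = 2 * pi); last first.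
  by rewrite ger0_norm//; lra.
have : 0 < (modulus L - M) * pi by rewrite mulr_gt0// subr_gt0.
lra.
Qed.

End CircleBound.

(** * Second-order expansion of a holomorphic function *)
Section SecondOrder.
Context {R : realType}.
Local Notation C := (Cplx R).
Implicit Types (f : C -> C) (z w D : C).

Lemma has_cderiv_shift f w z D :
  has_cderiv f (w + z) D -> has_cderiv (fun u => f (w + u)) z D.
Proof. by move=> fD e /fD[d d0 dP]; exists d => // h /dP; rewrite addrA. Qed.

Lemma has_cderivB f g z D E :
  has_cderiv f z D -> has_cderiv g z E -> has_cderiv (f \- g) z (D - E).
Proof.
move=> df dg e e0; have e2 : 0 < e / 2 by rewrite divr_gt0.
have [d1 d10 P1] := df _ e2; have [d2 d20 Q1] := dg _ e2.
exists (Num.min d1 d2) => [|h]; first by rewrite lt_min d10.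
rewrite lt_min => /andP[/P1 sP /Q1 sQ].
have -> : (f \- g) (z + h) - (f \- g) z - (D - E) * h =
  (f (z + h) - f z - D * h) - (g (z + h) - g z - E * h) by rewrite /=; ring.
by apply: le_trans (modulusB _ _) _; lra.
Qed.

Lemma has_cderiv_linear D z : has_cderiv (fun u => D * u) z D.
Proof.
move=> e e0; exists 1 => // h _.
have -> : D * (z + h) - D * z - D * h = 0 by ring.
by rewrite modulus0 mulr_ge0 ?modulus_ge0// ltW.
Qed.

(** Cauchy's estimate: the quotient [(f z - f 0) / z] has the derivative as its limit at 0, so the
    bound on circles applies to it. *)
Lemma cderiv0_bound f (rho r M : R) : 0 < r < rho ->
  (forall z, modulus z < rho -> derivable f z 1) ->
  (forall z, modulus z = r -> modulus (f z - f 0) <= M) ->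
  modulus (derive1 f 0) <= M / r.
Proof.
move=> /andP[r0 rrho] df fM.
apply: (@circle_bound R (fun z => (f z - f 0) * z^-1) rho r).
- by rewrite r0.
- move=> z /andP[z0 zrho]; apply: derivableM.
    by apply: derivableB; [exact: df|exact: derivable_cst].
  apply: derivableV; last exact: derivable_id.
  by rewrite -modulus_gt0.
- move=> e e0; have /derivable_has_cderiv/(_ _ e0)[d d0 dP] : derivable f 0 1.
    by apply: df; rewrite modulus0 (lt_trans r0).
  exists d => // z /andP[z0 /dP]; rewrite add0r => fz.
  have zn0 : z != 0 by rewrite -modulus_gt0.
  rewrite (_ : _ - _ = (f z - f 0 - derive1 f 0 * z) * z^-1); last first.
    by rewrite [RHS]mulrBl mulfK.
  by rewrite modulusM modulusV ler_pdivrMr.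
- move=> z zr; rewrite modulusM modulusV zr.
  by apply: ler_wpM2r; [rewrite invr_ge0 ltW|exact: fM].
Qed.

Lemma cmean_value_inequality f (u v : C) (K : R) :
  (forall t, 0 <= t <= 1 -> exists2 D, has_cderiv f (u + t%:C * (v - u)) D &
    modulus D <= K) ->
  modulus (f v - f u) <= K * modulus (v - u).
Proof.
move=> df; pose P (t : R) : C := f (u + t%:C * (v - u)).
have -> : f v - f u = P 1 - P 0 by rewrite /P mul1r mul0r addr0 (addrC u) subrK.
rewrite -[leRHS]mulr1 -[X in _ * X](subr0 1).
apply: rmean_value_inequality => // t t01.
have [D fD DK] := df _ t01; exists (D * (v - u)); last first.
  by rewrite modulusM ler_wpM2r// modulus_ge0.
set n := modulus (v - u); have n0 : 0 <= n by exact: modulus_ge0.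
move=> e e0; have [d d0 dP] := fD (e / (n + 1)) ltac:(rewrite divr_gt0//; lra).
exists (d / (n + 1)); first by rewrite divr_gt0//; lra.
move=> s; rewrite ltr_pdivlMr ?ltr_wpDl// => st.
have := dP ((s - t)%:C * (v - u)); rewrite modulusM modulus_real -/n.
rewrite (_ : u + t%:C * (v - u) + (s - t)%:C * (v - u) = u + s%:C * (v - u));
  last by ring.
rewrite (_ : D * ((s - t)%:C * (v - u)) = D * (v - u) * (s - t)%:C); last by ring.
have st0 := normr_ge0 (s - t).
move=> /(_ ltac:(nra)) h; apply: le_trans h _.
rewrite (mulrC _ n) mulrA ler_wpM2r// mulrAC ler_pdivrMr ?ltr_wpDl//; nra.
Qed.

(* [circle_bound] for difference quotients bounds [f'] near 0, so that [f] is
   Lipschitz; applied to [f (w + z) - f z] it then shows that [f'] is Lipschitz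
   at 0. *)
Lemma second_order_bound f (rho : R) : 0 < rho ->
  (forall z, modulus z < rho -> derivable f z 1) ->
  exists K d : R, [/\ 0 <= K, 0 < d & forall z, modulus z < d ->
    modulus (f z - f 0 - derive1 f 0 * z) <= K * modulus z ^+ 2].
Proof.
move=> rho0 df.
have f0 := derivable_has_cderiv _ _ (df 0 ltac:(by rewrite modulus0)).
have [s [s0 srho f1]] : exists s : R, [/\ 0 < s, s <= rho &
    forall z, modulus z < s -> modulus (f z - f 0) <= 1].
  have [d d0 dP] := f0 1 ltr01; set n := modulus (derive1 f 0) in dP *.
  have n0 : 0 <= modulus (derive1 f 0) by exact: modulus_ge0.
  exists (Num.min (Num.min d rho) (1 / (modulus (derive1 f 0) + 1))).
  rewrite !lt_min d0 rho0 divr_gt0 ?ltr_wpDl// !ge_min lexx orbT/=; split => // z.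
  rewrite !lt_min => /andP[/andP[zd _]]; rewrite ltr_pdivlMr ?ltr_wpDl// => zn.
  have := dP _ zd; rewrite add0r => fz.
  rewrite -(subrK (derive1 f 0 * z) (_ - _)); apply: le_trans (modulusD _ _) _.
  by rewrite modulusM; lra.
have dfs z : modulus z < s -> derivable f z 1.
  by move=> zs; apply: df; exact: lt_le_trans zs srho.
(* Cauchy's estimate on the circle of radius [s / 4] around [w], where [f] differs from [f w] by at
   most 2. *)
have f'1 w : modulus w < s / 2 -> modulus (derive1 f w) <= 2 / (s / 4).
  move=> ws; have dF z : modulus z < s / 2 ->
      has_cderiv (fun u => f (w + u)) z (derive1 f (w + z)).
    move=> zs; apply: has_cderiv_shift; apply: derivable_has_cderiv; apply: dfs.
    by apply: le_lt_trans (modulusD _ _) _; lra.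
  rewrite -[w in derive1 f w]addr0 -(has_cderiv_derive1 _ _ _ (dF 0 _)); last first.
    by rewrite modulus0; lra.
  apply: (@cderiv0_bound _ (s / 2)); first lra.
    by move=> z /dF; exact: has_cderiv_derivable.
  move=> z zs; rewrite addr0.
  have -> : f (w + z) - f w = (f (w + z) - f 0) - (f w - f 0) by ring.
  apply: le_trans (modulusB _ _) _.
  have := f1 w ltac:(lra); have := f1 (w + z); have := modulusD w z.
  by move=> wz /(_ ltac:(lra)); lra.
have lip u v : modulus u < s / 2 -> modulus v < s / 2 ->
    modulus (f v - f u) <= 2 / (s / 4) * modulus (v - u).
  move=> us vs; apply: cmean_value_inequality => t /andP[t0 t1].
  have segs : modulus (u + t%:C * (v - u)) < s / 2.
    have -> : u + t%:C * (v - u) = (1 - t)%:C * u + t%:C * v by ring.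
    apply: le_lt_trans (modulusD _ _) _; rewrite !modulusM !modulus_real.
    rewrite !ger0_norm; [|lra|lra].
    pose m := Num.max (modulus u) (modulus v).
    have ms : m < s / 2 by rewrite gt_max us.
    have : (1 - t) * modulus u <= (1 - t) * m.
      by apply: ler_wpM2l; [lra|rewrite le_max lexx].
    have : t * modulus v <= t * m by rewrite ler_wpM2l// le_max lexx orbT.
    lra.
  exists (derive1 f (u + t%:C * (v - u))); last exact: f'1.
  by apply: derivable_has_cderiv; apply: dfs; lra.
(* On the circle of radius [s / 8], [f (w + z) - f z] differs from its value at [z = 0] by at most
   twice the Lipschitz bound [2 / (s / 4) * modulus w]; Cauchy's estimate divides by [s / 8]. *)
pose K := 2 * (2 / (s / 4)) / (s / 8).
have f'lip w : modulus w < s / 8 ->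
    modulus (derive1 f w - derive1 f 0) <= K * modulus w.
  move=> ws; pose F : C -> C := (fun u => f (w + u)) \- f.
  have dF z : modulus z < s / 4 -> has_cderiv F z (derive1 f (w + z) - derive1 f z).
    move=> zs; apply: has_cderivB; last by apply: derivable_has_cderiv; apply: dfs; lra.
    apply: has_cderiv_shift; apply: derivable_has_cderiv; apply: dfs.
    by apply: le_lt_trans (modulusD _ _) _; lra.
  have := has_cderiv_derive1 _ _ _ (dF 0 ltac:(rewrite modulus0; lra)).
  rewrite addr0 => <-.
  have -> : K * modulus w = 2 * (2 / (s / 4)) * modulus w / (s / 8) by rewrite /K; ring.
  apply: (@cderiv0_bound _ (s / 4)); first lra.
    by move=> z /dF; exact: has_cderiv_derivable.
  move=> z zs; rewrite /F /= addr0; apply: le_trans (modulusB _ _) _.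
  have := lip z (w + z) ltac:(lra); have := lip 0 w; rewrite subr0 modulus0 addrK.
  have := modulusD w z => wz /(_ ltac:(lra) ltac:(lra)) h1 /(_ ltac:(lra)) h2.
  lra.
have K0 : 0 <= K by rewrite /K !mulr_ge0// invr_ge0; lra.
exists K, (s / 8); split => //; first lra.
move=> z zs; pose g : C -> C := f \- (fun u => derive1 f 0 * u).
have -> : f z - f 0 - derive1 f 0 * z = g z - g 0 by rewrite /g /= mulr0; ring.
rewrite expr2 mulrA -[X in _ * X](congr1 modulus (subr0 z)).
apply: cmean_value_inequality => t /andP[t0 t1]; rewrite add0r subr0.
have tz : modulus (t%:C * z) <= modulus z.
  by rewrite modulusM modulus_real ger0_norm// ler_piMl// modulus_ge0.
exists (derive1 f (t%:C * z) - derive1 f 0).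
  apply: has_cderivB; last exact: has_cderiv_linear.
  by apply: derivable_has_cderiv; apply: dfs; lra.
by apply: le_trans (f'lip _ _) _; [lra|rewrite ler_wpM2l].
Qed.

End SecondOrder.

(** * Spectra, and a nilpotent curve *)
Section Spectrum.
Context {R : realType}.
Local Notation C := (Cplx R).

Lemma trig_mulmx n (S T : 'M[C]_n) : is_trig_mx S -> is_trig_mx T ->
  is_trig_mx (S *m T) /\ forall i, (S *m T) i i = S i i * T i i.
Proof.
move=> /is_trig_mxP tS /is_trig_mxP tT; split.
  apply/is_trig_mxP => i j ij; rewrite mxE big1// => k _.
  have [ik|ki] := ltnP i k; first by rewrite tS// mul0r.
  by rewrite tT ?mulr0// (leq_ltn_trans ki).
move=> i; rewrite mxE (bigD1 i)//= big1 ?addr0// => k ki.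
have [ik|ki'] := ltnP i k; first by rewrite tS// mul0r.
by rewrite tT ?mulr0// ltn_neqAle ki' andbT.
Qed.

Lemma trace_diag_bound n (T : 'M[C]_n) : (forall i, modulus (T i i) <= 1) ->
  modulus (\tr T) <= n%:R.
Proof.
move=> T1; have -> : n%:R = \sum_(i < n) (1 : R).
  by rewrite sumr_const card_ord.
rewrite /mxtrace; elim/big_ind2 : _ => // [|x1 x2 y1 y2 h1 h2].
  by rewrite modulus0.
by apply: le_trans (modulusD _ _) _; exact: lerD.
Qed.

(** In Schur's triangular form the diagonal consists of eigenvalues, and the diagonals of the square
    and the cube are their powers. *)
Lemma trace_eigenvalue_bound n (M : 'M[C]_n) : (0 < n)%N ->
  (forall l, eigenvalue M l -> modulus l <= 1) ->
  modulus (\tr (M *m M)) <= n%:R /\ modulus (\tr (M *m M *m M)) <= n%:R.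
Proof.
move=> n0 M1; have [P /unitarymx_unit Pu] := Schur M n0.
rewrite /similar_to /= (conjumx M Pu); set T := P *m M *m invmx P => tT.
have MT : M = invmx P *m T *m P by rewrite /T !mulmxA mulVmx// mul1mx mulmxKV.
have T1 i : modulus (T i i) <= 1.
  apply: M1; have : eigenvalue T (T i i).
    rewrite eigenvalue_root_char char_poly_trig//.
    by rewrite (bigD1 i)//= rootM root_XsubC eqxx.
  have Pfree : row_free P by rewrite row_free_unit.
  by rewrite /T -(conjumx M Pu); exact: (eigenvalue_conjmx (stablemx_unit M Pu) Pfree).
clearbody T; have [tTT TT] := trig_mulmx _ T T tT tT.
have [tTTT TTT] := trig_mulmx _ _ T tTT tT.
have mul1 (x y : C) : modulus x <= 1 -> modulus y <= 1 -> modulus (x * y) <= 1.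
  by move=> x1 y1; rewrite modulusM mulr_ile1 ?modulus_ge0.
have trMT X : \tr (invmx P *m X *m P) = \tr X.
  by rewrite -mulmxA mxtrace_mulC mulmxK.
have MMT : M *m M = invmx P *m (T *m T) *m P.
  by rewrite MT !mulmxA (mulmxK Pu).
have -> : M *m M *m M = invmx P *m (T *m T *m T) *m P.
  by rewrite MMT MT !mulmxA (mulmxK Pu).
rewrite MMT !trMT.
by split; apply: trace_diag_bound => i; rewrite ?TTT ?TT ?mul1.
Qed.

(** Needed because the [sup] of an unbounded set is a default value: only with an upper bound does
    [spectral_radius] dominate each eigenvalue. The sum of the moduli of the roots of the
    characteristic polynomial serves. *)
Lemma spectrum_modulus_ubound n (M : 'M[C]_n) :
  has_ubound (@modulus R @` spectrum M).
Proof.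
have [r rE] := closed_field_poly_normal (char_poly M).
exists (\sum_(z <- r) modulus z) => _ [l + <-].
rewrite /spectrum /= eigenvalue_root_char rE rootZ; last first.
  by rewrite lead_coef_eq0 monic_neq0// char_poly_monic.
rewrite root_prod_XsubC => lr; rewrite (big_rem l)//= lerDl.
by apply: sumr_ge0 => z _; exact: modulus_ge0.
Qed.

Lemma spectral_ball_eigenvalue n (M : 'M[C]_n) l :
  spectral_ball R n M -> eigenvalue M l -> modulus l < 1.
Proof.
move=> M1 Ml; apply: le_lt_trans M1; apply: ub_le_sup; last by exists l.
exact: spectrum_modulus_ubound.
Qed.

Lemma eigenvalue_spectral_ball n (M : 'M[C]_n) (x : R) : 0 <= x < 1 ->
  (forall l, eigenvalue M l -> modulus l <= x) -> spectral_ball R n M.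
Proof.
move=> /andP[x0 x1] Mx; rewrite /spectral_ball /= /spectral_radius.
(* The spectrum is empty only for [n = 0], and then [sup] is 0 by convention. *)
have [->|/set0P ne] := eqVneq (@modulus R @` spectrum M) set0.
  by rewrite sup0.
by apply: le_lt_trans x1; apply: ge_sup => // _ [l Ml <-]; exact: Mx.
Qed.

Lemma spectrum_eq0 n (M : 'M[C]_n) : (0 < n)%N ->
  (forall l, eigenvalue M l -> l = 0) -> spectrum M = [set 0].
Proof.
move=> n0 M0; apply/seteqP; split => [l /M0//|_ ->].
by have [l Ml] := eigenvalue_closed M n0; rewrite /spectrum /= -(M0 _ Ml).
Qed.

End Spectrum.

Section Example.
Context {R : realType}.
Local Notation C := (Cplx R).
Context {n : nat} (i j l : 'I_n).
Context (ij : i != j) (il : i != l) (jl : j != l).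

Definition base_point : 'M[C]_n := delta_mx j i.
Definition direction : 'M[C]_n := delta_mx i i - delta_mx l l.
(* On the indices [i], [j], [l] this is
   [[s^2, -s^4, s^3], [1, 0, 0], [0, s^3, -s^2]], whose characteristic
   polynomial is [X^3]. *)
Definition nilpotent_curve (s : C) : 'M[C]_n :=
  base_point + s ^+ 2 *: (direction - s ^+ 2 *: delta_mx i j
    + s *: (delta_mx l j + delta_mx i l)).

Let A := base_point.
Let B := direction.

Lemma mulmx_deltaE (v : 'rV[C]_n) (a b c : 'I_n) :
  (v *m (delta_mx a b : 'M[C]_n)) 0 c = v 0 a *+ (b == c).
Proof.
rewrite mxE (bigD1 a)//= big1 => [|k ka]; last first.
  by rewrite mxE (negbTE ka) mulr0.
by rewrite mxE eqxx addr0 mulr_natr eq_sym.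
Qed.

(** Up to reordering, [A + z *: B] is triangular with diagonal entries [z], [- z] and 0. At [z = 0]
    this makes [A] nilpotent; for [modulus z < 1] it supplies an affine disc in the ball. *)
Lemma eigenvalue_affine z x : eigenvalue (A + z *: B) x -> modulus x <= modulus z.
Proof.
move=> /eigenvalueP[v vE v0]; rewrite leNgt; apply/negP => zx.
have x0 : x != 0 by rewrite -modulus_gt0 (le_lt_trans (modulus_ge0 z)).
have xz : x - z != 0.
  by apply: contraTneq zx => /eqP; rewrite subr_eq0 => /eqP ->; rewrite ltxx.
have xNz : x + z != 0.
  by apply: contraTneq zx => /eqP; rewrite addr_eq0 => /eqP ->; rewrite modulusN ltxx.
have vcE c : v 0 j *+ (i == c) + z * (v 0 i *+ (i == c) - v 0 l *+ (l == c)) = x * v 0 c.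
  have := congr1 (fun u : 'rV_n => u 0 c) vE.
  by rewrite /A /B /base_point /direction mulmxDr -scalemxAr mulmxBr !mxE
    -!mulmx_deltaE !mxE.
have vc c : c != i -> v 0 c = 0.
  move=> ci; have := vcE c; rewrite [i == c]eq_sym (negbTE ci) !mulr0n add0r sub0r.
  have [<-|_] := eqVneq l c.
    move=> h; apply: (mulfI xNz); rewrite mulr0 mulrDl -h mulr1n.
    by ring.
  by rewrite mulr0n oppr0 mulr0 => /esym/eqP; rewrite mulf_eq0 (negbTE x0) => /eqP.
have vi : v 0 i = 0.
  have := vcE i; rewrite eqxx (vc j) 1?eq_sym// (vc l) 1?eq_sym//.
  rewrite !mul0rn !mulr1n add0r subr0 => h.
  by apply: (mulfI xz); rewrite mulr0 mulrBl -h subrr.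
move/eqP: v0; apply; apply/rowP => c; rewrite mxE.
by have [->|/vc] := eqVneq c i.
Qed.

Lemma eigenvalue_nilpotent_curve s x : s != 0 ->
  eigenvalue (nilpotent_curve s) x -> x = 0.
Proof.
move=> s0 /eigenvalueP[v vE v0]; apply/eqP/negPn/negP => x0.
have vcE c : v 0 j *+ (i == c) + s ^+ 2 * (v 0 i *+ (i == c) - v 0 l *+ (l == c)
    - s ^+ 2 * (v 0 i *+ (j == c)) + s * (v 0 l *+ (j == c) + v 0 i *+ (l == c)))
    = x * v 0 c.
  have := congr1 (fun u : 'rV_n => u 0 c) vE.
  rewrite /nilpotent_curve /base_point /direction mulmxDr -scalemxAr !mulmxDr mulmxN.
  by rewrite mulmxN -!scalemxAr mulmxDr !mxE -!mulmx_deltaE !mxE.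
have := vcE i; have := vcE j; have := vcE l.
rewrite !eqxx [l == i]eq_sym [l == j]eq_sym [j == i]eq_sym.
rewrite (negbTE ij) (negbTE il) (negbTE jl).
rewrite !(mulr0n, mulr1n, oppr0, add0r, addr0, sub0r, subr0, mulr0) => hl hj hi.
have vi : v 0 i = 0.
  (* Eliminating [v 0 j] and [v 0 l] from the three equations. *)
  apply: (mulfI (expf_neq0 3 x0)); rewrite mulr0.
  rewrite (_ : x ^+ 3 * v 0 i =
    - (s ^+ 3) * (s ^+ 2 * (- v 0 l + s * v 0 i) - x * v 0 l)
    - (x + s ^+ 2) * ((s ^+ 2 * (- (s ^+ 2 * v 0 i) + s * v 0 l) - x * v 0 j)
      + x * (v 0 j + s ^+ 2 * v 0 i - x * v 0 i))); last by ring.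
  by rewrite hl hj hi !subrr !(mulr0, addr0, subr0).
have vj : v 0 j = 0 by move: hi; rewrite vi => h; rewrite -[RHS](mulr0 x) -h; ring.
(* Once [v 0 i = 0], the equation at [j] reads [s ^+ 3 * v 0 l = x * v 0 j]; here [s != 0]
   enters. *)
have vl : v 0 l = 0.
  apply: (mulfI (expf_neq0 3 s0)); rewrite mulr0 -[RHS](mulr0 x) -[in RHS]vj -hj vi.
  by ring.
move/eqP: v0; apply; apply/rowP => c; rewrite mxE.
have [->//|ci] := eqVneq c i; have [->//|cj] := eqVneq c j.
have [->//|cl] := eqVneq c l.
have := vcE c; rewrite ![_ == c]eq_sym (negbTE ci) (negbTE cj) (negbTE cl) !mulr0n.
rewrite subr0 !(addr0, mulr0, subr0) => /esym/eqP.
by rewrite mulf_eq0 (negbTE x0) => /eqP.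
Qed.

End Example.

(** * The tangent cone at the base point *)

Section TangentCone.
Context {R : realType}.
Local Notation C := (Cplx R).
Context {n : nat} (i j l : 'I_n).
Context (ij : i != j) (il : i != l) (jl : j != l).

Let A : 'M[C]_n := base_point i j.
Let B : 'M[C]_n := direction i l.

Let n_gt0 : (0 < n)%N.
Proof. exact: leq_ltn_trans (ltn_ord i). Qed.

Lemma base_point_eigenvalue x : eigenvalue A x -> x = 0.
Proof.
move=> Ax; apply/eqP; rewrite -modulus_eq0 eq_le modulus_ge0 andbT -(@modulus0 R).
by apply: (eigenvalue_affine i j l ij il); rewrite scale0r addr0.
Qed.

Lemma base_point_spectral_ball : spectral_ball R n A.
Proof.
apply: (@eigenvalue_spectral_ball _ _ _ 0); first by rewrite lexx ltr01.
by move=> x /base_point_eigenvalue ->; rewrite modulus0.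
Qed.

Lemma affine_spectral_ball z : open_unit_disc z -> spectral_ball R n (A + z *: B).
Proof.
move=> z1; apply: (@eigenvalue_spectral_ball _ _ _ (modulus z)).
  by rewrite modulus_ge0.
by move=> x; exact: eigenvalue_affine.
Qed.

Lemma nilpotent_curve_isospectral s : s != 0 ->
  isospectral_variety A (nilpotent_curve i j l s).
Proof.
move=> s0; have X0 := eigenvalue_nilpotent_curve i j l ij il jl s _ s0; split.
  apply: (@eigenvalue_spectral_ball _ _ _ 0); first by rewrite lexx ltr01.
  by move=> x /X0 ->; rewrite modulus0.
by rewrite (spectrum_eq0 _ _ n_gt0 X0) (spectrum_eq0 _ _ n_gt0 base_point_eigenvalue).
Qed.

Lemma cvg_harmonicC : (fun k => (harmonic k)%:C : C) @ \oo --> (0 : C).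
Proof.
apply/cvgrPdist_le => e /gt0_realC[r r0 ->].
have /cvgrPdist_le/(_ r r0) := @cvg_harmonic R; apply: filterS => k.
by rewrite !sub0r !normrN normrE_modulus modulus_real lecR.
Qed.

Lemma direction_tangent_cone : tangent_cone (isospectral_variety A) A B.
Proof.
pose s (k : nat) : C := (harmonic k)%:C.
have s0 k : s k != 0.
  by rewrite -modulus_eq0 modulus_real normr_eq0 gt_eqF// harmonic_gt0.
pose D (k : nat) : 'M[C]_n := B - s k ^+ 2 *: delta_mx i j
    + s k *: (delta_mx l j + delta_mx i l).
have s_cvg : s @ \oo --> (0 : C) by exact: cvg_harmonicC.
have s2_cvg : (fun k => s k ^+ 2) @ \oo --> (0 : C).
  have -> : (fun k => s k ^+ 2) = (fun k => s k * s k) by [].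
  by rewrite -[0](mulr0 (0 : C)); apply: cvgM.
have D_cvg : D @ \oo --> B.
  have -> : B = B - 0 *: (delta_mx i j : 'M[C]_n)
      + 0 *: (delta_mx l j + delta_mx i l : 'M[C]_n).
    by rewrite !scale0r subr0 addr0.
  apply: cvgD; last exact: cvgZr_tmp.
  by apply: cvgB; [exact: cvg_cst|exact: cvgZr_tmp].
have XE k : nilpotent_curve i j l (s k) = A + s k ^+ 2 *: D k by [].
(* The curve leaves [A] at order [s ^+ 2], so the scaling factor is the inverse square of
   [s k = 1 / (k + 1)]. *)
exists (fun k => nilpotent_curve i j l (s k)), (fun k => k.+1%:R ^+ 2); split.
- by move=> k; exact: nilpotent_curve_isospectral.
- have -> : (fun k => nilpotent_curve i j l (s k)) = (fun k => A + s k ^+ 2 *: D k).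
    by [].
  have : (fun k => A + s k ^+ 2 *: D k) @ \oo --> A + 0 *: B.
    by apply: cvgD; [exact: cvg_cst|exact: cvgZ].
  by rewrite scale0r addr0.
- by move=> k; rewrite exprn_gt0.
- rewrite (_ : (fun k => _) = D) //; apply/funext => k.
  rewrite XE addrAC subrr add0r scalerA rmorphXn -exprMn -rmorphM.
  by rewrite /harmonic mulfV// rmorph1 expr1n scale1r.
Qed.

End TangentCone.

(** * Trace identities for the chosen pair of matrices *)

Section TraceIdentities.
Context {F : fieldType} {n : nat}.
Implicit Types X Y : 'M[F]_n.

Lemma mxtrace_sqrD X Y :
  \tr ((X + Y) *m (X + Y)) = \tr (X *m X) + \tr (X *m Y) *+ 2 + \tr (Y *m Y).
Proof.
rewrite mulmxDl !mulmxDr !mxtraceD (mxtrace_mulC Y X) mulr2n; ring.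
Qed.

(** Cyclicity of the trace merges the six mixed words into two classes of three. *)
Lemma mxtrace_cubeD X Y :
  \tr ((X + Y) *m (X + Y) *m (X + Y)) = \tr (X *m X *m X)
    + \tr (X *m X *m Y) *+ 3 + \tr (X *m Y *m Y) *+ 3 + \tr (Y *m Y *m Y).
Proof.
rewrite !(mulmxDl, mulmxDr) !mxtraceD.
have -> : \tr (X *m Y *m X) = \tr (X *m X *m Y).
  by rewrite mxtrace_mulC mulmxA.
have -> : \tr (Y *m X *m X) = \tr (X *m X *m Y).
  by rewrite -mulmxA mxtrace_mulC.
have -> : \tr (Y *m Y *m X) = \tr (X *m Y *m Y).
  by rewrite mxtrace_mulC mulmxA.
have -> : \tr (Y *m X *m Y) = \tr (X *m Y *m Y).
  by rewrite -mulmxA mxtrace_mulC.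
ring.
Qed.

Context (i j l : 'I_n) (ij : i != j) (il : i != l) (jl : j != l).
Let A : 'M[F]_n := delta_mx j i.
Let B : 'M[F]_n := delta_mx i i - delta_mx l l.

Lemma mxtrace_delta (a b : 'I_n) : \tr (delta_mx a b : 'M[F]_n) = (a == b)%:R.
Proof.
rewrite /mxtrace (bigD1 a)//= big1 => [|c ca]; last by rewrite mxE (negbTE ca).
by rewrite mxE eqxx addr0.
Qed.

Lemma mul_base_base : A *m A = 0.
Proof. by rewrite /A mul_delta_mx_cond (negbTE ij). Qed.

Lemma mul_base_direction : A *m B = A.
Proof. by rewrite /A /B mulmxBr !mul_delta_mx_cond eqxx (negbTE il) subr0. Qed.

Lemma mul_direction_base : B *m A = 0.
Proof.
by rewrite /A /B mulmxBl !mul_delta_mx_cond (negbTE ij) eq_sym (negbTE jl) subr0.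
Qed.

Lemma mul_direction_direction : B *m B = delta_mx i i + delta_mx l l.
Proof.
rewrite /B mulmxBl !mulmxBr !mul_delta_mx_cond !eqxx [l == i]eq_sym (negbTE il).
by rewrite !mulr0n !mulr1n subr0 sub0r opprK.
Qed.

(* With [N = b *: B + z *: E], the point [A + z *: N] is a disc through [A] in
   the direction [b *: B]. In this combination of the traces of its square and
   its cube the a priori unbounded term [\tr (A *m E)] cancels. *)
Lemma trace_combination (b z : F) (E : 'M[F]_n) :
  let N := b *: B + z *: E in let X := A + z *: N in
  2 * \tr (X *m X *m X) - 3 * b * z * \tr (X *m X) =
  z ^+ 3 * (- 6 * b ^+ 3 + z * (6 * \tr (A *m E *m E)
    + 6 * b ^+ 2 * \tr (B *m B *m E) + 6 * b * z * \tr (B *m E *m E)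
    + 2 * z ^+ 2 * \tr (E *m E *m E) - 6 * b ^+ 2 * \tr (B *m E)
    - 3 * b * z * \tr (E *m E))).
Proof.
move=> N X.
have trA : \tr A = 0 by rewrite mxtrace_delta eq_sym (negbTE ij).
have trBB : \tr (B *m B) = 2.
  by rewrite mul_direction_direction mxtraceD !mxtrace_delta !eqxx.
have trBBB : \tr (B *m B *m B) = 0.
  rewrite mul_direction_direction mulmxDl /B !mulmxBr !mul_delta_mx_cond !eqxx.
  rewrite [l == i]eq_sym (negbTE il) !mulr0n !mulr1n.
  by rewrite mxtraceD !raddfB /= !raddf0 !mxtrace_delta !eqxx; ring.
have trAN : \tr (A *m N) = z * \tr (A *m E).
  by rewrite mulmxDr -!scalemxAr mul_base_direction mxtraceD !mxtraceZ trA mulr0 add0r.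
have trAEB : \tr (A *m E *m B) = 0.
  by rewrite mxtrace_mulC mulmxA mul_direction_base mul0mx mxtrace0.
(* As [A *m B = A], the product [A *m N] is [b *: A + z *: (A *m E)]. The cube thus reproduces the
   term [\tr (A *m E)] of the square with an extra factor [b], which makes the cancellation
   possible. *)
have trANN : \tr (A *m N *m N) =
    b * (z * \tr (A *m E)) + z ^+ 2 * \tr (A *m E *m E).
  rewrite [X in X *m _]mulmxDr -!scalemxAr mul_base_direction mulmxDl -!scalemxAl.
  rewrite mxtraceD !mxtraceZ trAN mulmxDr -!scalemxAr mxtraceD !mxtraceZ trAEB.
  ring.
have trNN : \tr (N *m N) = 2 * b ^+ 2 + 2 * b * z * \tr (B *m E) + z ^+ 2 * \tr (E *m E).
  by rewrite mxtrace_sqrD -!scalemxAr -!scalemxAl !mxtraceZ trBB; ring.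
have trNNN : \tr (N *m N *m N) = 3 * b ^+ 2 * z * \tr (B *m B *m E)
    + 3 * b * z ^+ 2 * \tr (B *m E *m E) + z ^+ 3 * \tr (E *m E *m E).
  rewrite mxtrace_cubeD; do ![rewrite -scalemxAr | rewrite -scalemxAl].
  by rewrite !mxtraceZ trBBB; ring.
have -> : \tr (X *m X) = 2 * z * (z * \tr (A *m E)) + z ^+ 2 * \tr (N *m N).
  rewrite mxtrace_sqrD -!scalemxAr -!scalemxAl mul_base_base mxtrace0 !mxtraceZ trAN.
  ring.
have -> : \tr (X *m X *m X) = 3 * z ^+ 2 * \tr (A *m N *m N) + z ^+ 3 * \tr (N *m N *m N).
  rewrite mxtrace_cubeD mul_base_base !mul0mx !mxtrace0 !mul0rn.
  do ![rewrite -scalemxAr | rewrite -scalemxAl]; rewrite !mxtraceZ; ring.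
rewrite trANN trNN trNNN; ring.
Qed.

End TraceIdentities.

(** * Discs in the spectral ball *)
Section MatrixDiscs.
Context {R : realType}.
Local Notation C := (Cplx R).
Context {n : nat}.
Implicit Types (f g : C -> 'M[C]_n) (X Y Z : 'M[C]_n).

Lemma cvg_derive1_mx f z a b : derivable f z 1 ->
  (fun h => h^-1 *: (f (h *: 1 + z) a b - f z a b)) @ 0^' --> derive1 f z a b.
Proof.
move=> df; rewrite derive1E.
have fE : (fun h => h^-1 *: (f (h *: 1 + z) a b - f z a b)) =
    (fun M : 'M[C]_n => M a b) \o (fun h : C => h^-1 *: (f (h *: 1 + z) - f z)).
  by apply/funext => h; rewrite /= !mxE.
by rewrite fE; apply: continuous_cvg; [exact: coord_continuous|exact: df].
Qed.

Lemma derivable_mx_coord f z a b :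
  derivable f z 1 -> derivable (fun u => f u a b) z 1.
Proof. by move=> /cvg_derive1_mx-/(_ a b) fab; apply/cvg_ex; exists (derive1 f z a b). Qed.

Lemma derive1_mx_coord f z a b :
  derivable f z 1 -> derive1 (fun u => f u a b) z = derive1 f z a b.
Proof.
move=> df; rewrite [LHS]derive1E; apply: cvg_lim; first exact: norm_hausdorff.
exact: cvg_derive1_mx.
Qed.

Lemma derivable_mulmx_coord f g z :
  (forall a b, derivable (fun u => f u a b) z 1) ->
  (forall a b, derivable (fun u => g u a b) z 1) ->
  forall a b, derivable (fun u => (f u *m g u) a b) z 1.
Proof.
move=> df dg a b.
have -> : (fun u => (f u *m g u) a b) = \sum_(c < n) (fun u => f u a c * g u c b).
  by rewrite fct_sumE; apply/funext => u; rewrite mxE.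
by apply: derivable_sum => c; exact: derivableM.
Qed.

Lemma derivable_mxtrace f z : (forall a b, derivable (fun u => f u a b) z 1) ->
  derivable (fun u => \tr (f u)) z 1.
Proof.
move=> df.
have -> : (fun u => \tr (f u)) = \sum_(c < n) (fun u => f u c c).
  by rewrite fct_sumE.
exact: derivable_sum.
Qed.

Lemma is_derive_affine (X Y : 'M[C]_n) (z : C) :
  is_derive z (1 : C) (fun u : C => X + u *: Y) Y.
Proof.
have cvgY : (fun h => h^-1 *: (X + (h *: 1 + z) *: Y - (X + z *: Y))) @ 0^' --> Y.
  apply: cvg_near_cst; rewrite near_withinE; near=> h => h0.
  by rewrite opprD addrACA subrr add0r -scalerBl addrK scalerA -[h *: 1]/(h * 1)
    mulr1 mulVf// scale1r.
by split; [apply/cvg_ex; exists Y|apply/cvg_lim].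
Unshelve. all: by end_near. Qed.

(** The largest modulus of an entry is submultiplicative up to the factor [n], which is enough for
    boundedness near 0. *)
Lemma mulmx_entry_bound X Y (x y : R) :
  (forall a b, modulus (X a b) <= x) -> (forall a b, modulus (Y a b) <= y) ->
  forall a b, modulus ((X *m Y) a b) <= n%:R * (x * y).
Proof.
move=> Xx Yy a b; have -> : n%:R * (x * y) = \sum_(c < n) (x * y).
  by rewrite sumr_const card_ord mulr_natl.
rewrite mxE; elim/big_ind2 : _ => [|x1 x2 y1 y2 h1 h2|c _]; first by rewrite modulus0.
  by apply: le_trans (modulusD _ _) _; exact: lerD.
by rewrite modulusM ler_pM// modulus_ge0.
Qed.

Lemma mxtrace_entry_bound X (x : R) : (forall a b, modulus (X a b) <= x) ->
  modulus (\tr X) <= n%:R * x.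
Proof.
move=> Xx; have -> : n%:R * x = \sum_(c < n) x.
  by rewrite sumr_const card_ord mulr_natl.
rewrite /mxtrace; elim/big_ind2 : _ => // [|x1 x2 y1 y2 h1 h2].
  by rewrite modulus0.
by apply: le_trans (modulusD _ _) _; exact: lerD.
Qed.

Lemma mxtrace_mul2_bound X Y (x y : R) :
  (forall a b, modulus (X a b) <= x) -> (forall a b, modulus (Y a b) <= y) ->
  modulus (\tr (X *m Y)) <= n%:R * (n%:R * (x * y)).
Proof. by move=> Xx Yy; apply: mxtrace_entry_bound; exact: mulmx_entry_bound. Qed.

Lemma mxtrace_mul3_bound X Y Z (x y z : R) :
  (forall a b, modulus (X a b) <= x) -> (forall a b, modulus (Y a b) <= y) ->
  (forall a b, modulus (Z a b) <= z) ->
  modulus (\tr (X *m Y *m Z)) <= n%:R * (n%:R * (n%:R * (x * y) * z)).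
Proof.
move=> Xx Yy Zz; apply: mxtrace_entry_bound; apply: mulmx_entry_bound => //.
exact: mulmx_entry_bound.
Qed.

(** Entrywise from the scalar case: finitely many punctured neighbourhoods have a common radius, and
    the sum of the constants dominates each of them. *)
Lemma second_order_mx_bound f : holomorphic_on_disc f ->
  exists K d : R, [/\ 0 <= K, 0 < d & forall z, z != 0 -> modulus z < d ->
    forall a b, modulus ((f z - f 0 - z *: derive1 f 0) a b) <= K * modulus z ^+ 2].
Proof.
move=> hf.
have /choice[K KP] : forall p : 'I_n * 'I_n, exists K : R, 0 <= K /\
    \forall z \near (0 : C)^',
      modulus ((f z - f 0 - z *: derive1 f 0) p.1 p.2) <= K * modulus z ^+ 2.
  move=> [a b]; have [|K [d [K0 d0 KP]]] :=
      @second_order_bound R (fun z => f z a b) 1 ltr01.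
    by move=> z z1; apply: derivable_mx_coord; exact: hf.
  exists K; split => //; apply/dnbhs0_modulusP; exists d => // z _ /KP.
  rewrite derive1_mx_coord; last first.
    by apply: hf; rewrite /open_unit_disc /mkset modulus0.
  by rewrite !mxE [X in _ - X]mulrC.
exists (\sum_p K p).
have /dnbhs0_modulusP[d d0 dP] : \forall z \near (0 : C)^', forall p,
    modulus ((f z - f 0 - z *: derive1 f 0) p.1 p.2) <= K p * modulus z ^+ 2.
  by apply: filter_forall => p; case: (KP p).
exists d; split => //; first by apply: sumr_ge0 => p _; case: (KP p).
move=> z z0 zd a b; apply: le_trans (dP z z0 zd (a, b)) _.
rewrite ler_wpM2r ?exprn_ge0 ?modulus_ge0// (bigD1 (a, b))//= lerDl.
by apply: sumr_ge0 => p _; case: (KP p).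
Qed.

End MatrixDiscs.

Section DiscBound.
Context {R : realType}.
Local Notation C := (Cplx R).

Lemma modulus_nat k : modulus (k%:R : C) = k%:R.
Proof.
have -> : k%:R = (k%:R : R)%:C :> C by rewrite rmorph_nat.
by rewrite modulus_real ger0_norm.
Qed.

Context {n : nat} (i j l : 'I_n).
Context (ij : i != j) (il : i != l) (jl : j != l) (n3 : (3 <= n)%N).
Let A : 'M[C]_n := base_point i j.
Let B : 'M[C]_n := direction i l.

Lemma base_point_entry a b : modulus (A a b) <= 1.
Proof. by rewrite mxE modulus_nat; case: andP. Qed.

Lemma direction_entry a b : modulus (B a b) <= 2.
Proof.
rewrite !mxE; apply: le_trans (modulusB _ _) _; rewrite !modulus_nat -natrD ler_nat.
by do 2 case: andP.
Qed.

Let k b (X : 'M[C]_n) (z : C) : C :=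
  (2 * \tr (X *m X *m X) - 3 * b * z * \tr (X *m X)) * z ^- 3.

(** The remainder [E] is only known to be bounded near 0. This suffices because, after the
    cancellation, every term containing [E] carries a further factor [z]. *)
Lemma trace_combination_limit (b : C) (f : C -> 'M[C]_n) : holomorphic_on_disc f ->
  f 0 = A -> derive1 f 0 = b *: B -> forall e : R, 0 < e -> exists2 d : R, 0 < d &
  forall z, 0 < modulus z < d -> modulus (k b (f z) z - (- 6 * b ^+ 3)) <= e.
Proof.
move=> hf f0 f'0 e e0; have [K [d [K0 d0 KP]]] := second_order_mx_bound _ hf.
pose m := modulus b; have m0 : 0 <= m by exact: modulus_ge0.
pose N : R := n%:R.
(* Bounds for the six remaining traces, from entries of modulus at most 1 in [A], 2 in [B] and [K]
   in [E]. *)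
pose T1 := N * (N * (N * (1 * K) * K)); pose T2 := N * (N * (N * (2 * 2) * K)).
pose T3 := N * (N * (N * (2 * K) * K)); pose T4 := N * (N * (N * (K * K) * K)).
pose T5 := N * (N * (2 * K)); pose T6 := N * (N * (K * K)).
have [T10 T20 T30] : [/\ 0 <= T1, 0 <= T2 & 0 <= T3] by rewrite !mulr_ge0.
have [T40 T50 T60] : [/\ 0 <= T4, 0 <= T5 & 0 <= T6] by rewrite !mulr_ge0.
pose T := 6 * T1 + 6 * m ^+ 2 * T2 + 6 * m * T3 + 2 * T4 + 6 * m ^+ 2 * T5 + 3 * m * T6.
have T0 : 0 <= T by rewrite !addr_ge0// !mulr_ge0// exprn_ge0.
have dT0 : 0 < e / (T + 1) by rewrite divr_gt0// ltr_wpDl.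
exists (Num.min (Num.min d 1) (e / (T + 1))); first by rewrite !lt_min d0 ltr01.
move=> z; rewrite modulus_gt0 !lt_min => /andP[z0 /andP[/andP[zd z1] zT]].
pose E : 'M[C]_n := z ^- 2 *: (f z - f 0 - z *: derive1 f 0).
have EK a c : modulus (E a c) <= K.
  rewrite mxE modulusM modulusV modulusX mulrC ler_pdivrMr; first exact: KP.
  by rewrite exprn_gt0// modulus_gt0.
have fE : f z = A + z *: (b *: B + z *: E).
  have zE : z *: (z *: E) = f z - f 0 - z *: derive1 f 0.
    by rewrite scalerA -expr2 /E scalerA mulfV ?expf_neq0// scale1r.
  by rewrite scalerDr zE f0 f'0 (addrC (z *: (b *: B))) subrK addrC subrK.
rewrite /k fE trace_combination// mulrAC mulfV ?expf_neq0// mul1r addrC addKr.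
rewrite modulusM; set S := (X in _ * modulus X).
have ST : modulus S <= T.
  have A1 := base_point_entry; have B2 := direction_entry.
  have t1 := mxtrace_mul3_bound _ _ _ _ _ _ A1 EK EK.
  have t2 := mxtrace_mul3_bound _ _ _ _ _ _ B2 B2 EK.
  have t3 := mxtrace_mul3_bound _ _ _ _ _ _ B2 EK EK.
  have t4 := mxtrace_mul3_bound _ _ _ _ _ _ EK EK EK.
  have t5 := mxtrace_mul2_bound _ _ _ _ B2 EK.
  have t6 := mxtrace_mul2_bound _ _ _ _ EK EK.
  have z2 : modulus z ^+ 2 <= 1 by rewrite expr_le1// ?modulus_ge0// ltW.
  have zle1 : modulus z <= 1 by exact: ltW.
  rewrite /S /T; apply: le_trans (modulusB _ _) _; apply: lerD.
    apply: le_trans (modulusB _ _) _; apply: lerD.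
      apply: le_trans (modulusD _ _) _; apply: lerD.
        apply: le_trans (modulusD _ _) _; apply: lerD.
          apply: le_trans (modulusD _ _) _; apply: lerD.
            by rewrite modulusM modulus_nat ler_wpM2l.
          by rewrite (modulusM (6 * _)) (modulusM 6) modulusX modulus_nat
            ler_wpM2l// mulr_ge0// exprn_ge0.
        rewrite !modulusM modulus_nat -/m ler_pM ?mulr_ge0 ?modulus_ge0//.
        by rewrite ler_piMr// mulr_ge0.
      by rewrite (modulusM (2 * _)) (modulusM 2) modulusX modulus_nat
        ler_pM ?mulr_ge0 ?exprn_ge0 ?modulus_ge0// ler_piMr.
    by rewrite (modulusM (6 * _)) (modulusM 6) modulusX modulus_nat
            ler_wpM2l// mulr_ge0// exprn_ge0.
  rewrite !modulusM modulus_nat -/m ler_pM ?mulr_ge0 ?modulus_ge0//.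
  by rewrite ler_piMr// mulr_ge0.
apply: (@le_trans _ _ (modulus z * T)); first by rewrite ler_wpM2l ?modulus_ge0.
apply: (@le_trans _ _ (e / (T + 1) * T)); first by rewrite ler_wpM2r// ltW.
by rewrite mulrAC ler_pdivrMr ?ltr_wpDl// ler_wpM2l ?(ltW e0)// lerDl.
Qed.

Lemma disc_derivative_bound (b : C) (f : C -> 'M[C]_n) : holomorphic_on_disc f ->
  (forall z, open_unit_disc z -> spectral_ball R n (f z)) ->
  f 0 = A -> derive1 f 0 = b *: B -> modulus b <= 2 * n%:R.
Proof.
move=> hf fO f0 f'0; pose N : R := n%:R; pose m := modulus b.
have m0 : 0 <= m by exact: modulus_ge0.
have N3 : 3 <= N by rewrite ler_nat.
(* On the circle of radius [1 / 2] both traces are at most [N], and division by [z ^+ 3] multiplies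
   [2 * N + 3 / 2 * m * N] by 8. *)
have : modulus (- 6 * b ^+ 3) <= 16 * N + 12 * m * N.
  apply: (@circle_bound R (fun z => k b (f z) z) 1 (1 / 2)).
  - lra.
  - move=> z /andP[z0 z1]; have df a c : derivable (fun u => f u a c) z 1.
      by apply: derivable_mx_coord; exact: hf.
    have dff := derivable_mulmx_coord _ _ _ df df.
    have dfff := derivable_mulmx_coord _ _ _ dff df.
    have d1 : derivable (fun u => 2 * \tr (f u *m f u *m f u)) z 1.
      by apply: derivableM; [exact: derivable_cst|exact: derivable_mxtrace].
    have d2 : derivable (fun u => 3 * b * u) z 1.
      by apply: derivableM; [exact: derivable_cst|exact: derivable_id].
    have d3 := derivableM d2 (derivable_mxtrace _ _ dff).
    have d4 : derivable (fun u : C => u ^- 3) z 1.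
      apply: derivableV; last exact: exprn_derivable.
      by rewrite expf_neq0// -modulus_gt0.
    exact: derivableM (derivableB d1 d3) d4.
  - exact: trace_combination_limit.
  - move=> z zr; have z1 : open_unit_disc z by rewrite /open_unit_disc /= zr; lra.
    have [x fx|t2 t3] := @trace_eigenvalue_bound R n (f z) (ltn_trans (isT : 0 < 2)%N n3).
      by apply: ltW; exact: spectral_ball_eigenvalue (fO z z1) fx.
    rewrite /k modulusM modulusV modulusX zr.
    have : modulus (2 * \tr (f z *m f z *m f z) - 3 * b * z * \tr (f z *m f z)) <=
        2 * N + 3 / 2 * m * N.
      apply: le_trans (modulusB _ _) _; rewrite !modulusM !modulus_nat zr -/m.
      apply: lerD; first by rewrite ler_wpM2l.
      rewrite (_ : 3 * m * (1 / 2) = 3 / 2 * m); last by field.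
      by rewrite ler_wpM2l// mulr_ge0.
    have -> : ((1 / 2) ^+ 3)^-1 = 8 :> R by field.
    lra.
rewrite modulusM modulusN modulus_nat modulusX -/m -/N => le_m.
rewrite leNgt; apply/negP => lt_m.
(* If [m > 2 * N], then [m ^+ 2 > 12 * N] by [3 <= N], so [6 * m ^+ 3] exceeds [72 * m * N] and
   hence the bound. *)
have : 0 <= m * (m - 2 * N) by rewrite mulr_ge0// subr_ge0 ltW.
nra.
Qed.

(** A competitor has derivative [alpha^-1 *: B] at 0, so the bound on [b] becomes the uniform lower
    bound [1 / (2 n)] on [modulus alpha]. *)
Lemma kobayashi_royden_gt0 : 0 < kobayashi_royden (spectral_ball R n) A B.
Proof.
have N0 : 0 < 2 * n%:R :> R by rewrite mulr_gt0// ltr0n (ltn_trans _ n3).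
apply: (@lt_le_trans _ _ (2 * n%:R)^-1); first by rewrite invr_gt0.
apply: lb_le_inf.
  (* The infimum of an empty set would be 0, so a competitor has to be exhibited. *)
  exists 1, 1, (fun z => A + z *: B); split.
  - by rewrite modulus1.
  - by move=> z _; have [] := is_derive_affine A B z.
  - by move=> z; exact: affine_spectral_ball.
  - by rewrite scale0r addr0.
  - by rewrite scale1r derive1E; have [] := is_derive_affine A B 0.
move=> _ [alpha [f [-> hf fO f0 f'0]]].
(* Otherwise [B] would vanish, but its entry at [(i, i)] is 1. *)
have alpha0 : alpha != 0.
  apply: contra_eq_neq f'0 => ->; rewrite scale0r eq_sym.
  apply/eqP => /matrixP/(_ i i); rewrite !mxE !eqxx (negbTE il) subr0 => /eqP.
  by rewrite oner_eq0.
have := disc_derivative_bound alpha^-1 f hf fO f0.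
rewrite -f'0 scalerA mulVf// scale1r => /(_ erefl); rewrite modulusV => h.
by rewrite -[leRHS]invrK lef_pV2 ?posrE ?invr_gt0 ?modulus_gt0.
Qed.

End DiscBound.

Theorem corollary7 (R : realType) (n : nat) (hn : (3 <= n)%N) :
  exists A B : 'M[Cplx R]_n,
    [/\ spectral_ball R n A,
        tangent_cone (isospectral_variety A) A B &
        0 < kobayashi_royden (spectral_ball R n) A B].
Proof.
have n1 : (1 < n)%N by exact: ltn_trans hn.
pose i := Ordinal (ltnW n1); pose j := Ordinal n1; pose l := Ordinal hn.
exists (base_point i j), (direction i l); split.
- exact: (base_point_spectral_ball i j l).
- exact: (direction_tangent_cone i j l).
- exact: (kobayashi_royden_gt0 i j l).
Qed.
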